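(* Let $\Lambda$ be a superpartition of $(n|m)$ and $\Lambda'$ its conjugate. Then $$\overleftarrow{e_\Lambda}:=\tilde e_{\Lambda_m}\cdots\tilde e_{\Lambda_1}\,e_{\Lambda_{m+1}}\cdots e_{\Lambda_{\ell(\Lambda)}}=m_{\Lambda'}+\sum_{\Omega<\Lambda'}N_\Lambda^\Omega\, m_\Omega ,$$ where each $N_\Lambda^\Omega$ is an integer and $<$ is the Bruhat order on superpartitions. Hence $\{e_\Lambda:\Lambda\vdash(n|m)\}$ is a basis of the $\mathbb{Z}$-module $\mathscr{P}^{S_\infty}_{(n|m)}(\mathbb{Z})$.
   Context: Superpartitions. A superpartition of $(n|m)$, written $\Lambda\vdash(n|m)$, is $\Lambda=(\Lambda^a;\Lambda^s)=(\Lambda_1,\dots,\Lambda_m;\Lambda_{m+1},\Lambda_{m+2},\dots)$ with nonnegative integer entries, $\Lambda_1>\dots>\Lambda_m\ge 0$, $\Lambda_{m+1}\ge\Lambda_{m+2}\ge\dots\ge0$ (finitely many nonzero; trailing zeros of $\Lambda^s$ ignored) and $\sum_i\Lambda_i=n$; $\ell(\Lambda)=m+\#\{\text{nonzero parts of }\Lambda^s\}$. The diagram of $\Lambda$ is obtained by reordering all entries decreasingly, circling each entry coming from $\Lambda^a$ (when such an entry equals entries of $\Lambda^s$, the leftmost one is circled), drawing left-justified rows of boxes of these lengths from top to bottom, and adding a circle at the end of each row corresponding to a circled entry (a circled $0$ gives a row consisting of just a circle). The conjugate $\Lambda'$ is the superpartition whose diagram is the transpose of that of $\Lambda$. Bruhat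 order. For superpartitions $\Lambda,\Omega$ of the same $(n|m)$, let $\Lambda^c$, $\Omega^c$ be the compositions obtained by replacing the semicolon by a comma (padded with zeros to a common length). For compositions $\lambda,\mu$ let $\lambda^+$ be the decreasing rearrangement and $w_\lambda$ the minimal-length permutation with $\lambda=w_\lambda\lambda^+$; $\lambda\ge\mu$ iff either $\lambda^+>\mu^+$ in dominance order, or $\lambda^+=\mu^+$ and $w_\lambda\le w_\mu$ in the Bruhat order of the symmetric group. Set $\Omega\le\Lambda$ iff $\Omega^c\le\Lambda^c$. Symmetric superfunctions. The $x_i$ ($i\ge1$) commute, the $\theta_i$ anticommute ($\theta_i^2=0$) and commute with the $x_i$. $\mathscr{P}^{S_\infty}_{(n|m)}(\mathbb{Z})$ is the $\mathbb{Z}$-module of formal series with integer coefficients, homogeneous of degree $n$ in $x$ and $m$ in $\theta$, invariant under simultaneous permutations of the pairs $(x_i,\theta_i)$. $m_\Lambda$ is the sum of all distinct terms obtained from $\theta_1\cdots\theta_m x_1^{\Lambda_1}x_2^{\Lambda_2}\cdots$ by simultaneous permutations of the pairs $(x_i,\theta_i)$. Further, $e_n=\sum_{j_1<\dots<j_n}x_{j_1}\cdots x_{j_n}$, $e_0=1$, $\tilde e_n=\sum_{i\ge1}\sum_{j_1<\dots<j_n,\ i\notin\{j_1,\dots,j_n\}}\theta_i x_{j_1}\cdots x_{j_n}$, $\tilde e_0=\sum_i\theta_i$, and $e_\Lambda=\tilde e_{\Lambda_1}\cdots\tilde e_{\Lambda_m}e_{\Lambda_{m+1}}\cdots e_{\Lambda_{\ell(\Lambda)}}$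 (products taken in this order). *)

(* Defs.v *)
From HB Require Import structures.
From mathcomp Require Import all_boot all_order all_fingroup all_algebra.
From mathcomp Require Import finmap multiset.
From mathcomp Require Import all_classical.

Set Implicit Arguments.
Unset Strict Implicit.
Unset Printing Implicit Defensive.

Import GRing.Theory.

Local Open Scope nat_scope.

(* [p.1] is the antisymmetric part; [p.2] lists the nonzero parts of the
   symmetric one, so that equality ignores trailing zeros. *)
Definition is_superpart (n m : nat) (p : seq nat * seq nat) : bool :=
  [&& size p.1 == m, sorted gtn p.1, sorted geq p.2, 0 \notin p.2
    & sumn p.1 + sumn p.2 == n].

Record superpart (n m : nat) := Superpart {
  sp_val :> seq nat * seq nat;
  _ : is_superpart n m sp_val }.

HB.instance Definition _ n m := [isSub for @sp_val n m].
HB.instance Definition _ n m := [Countable of superpart n m by <:].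

Section SuperpartFinite.
Variables n m : nat.
Implicit Type L : superpart n m.

Lemma superpartP L : is_superpart n m L.
Proof. by case: L. Qed.

Lemma mem_leq_sumn (s : seq nat) x : x \in s -> x <= sumn s.
Proof.
elim: s => //= y s IHs; rewrite in_cons => /orP[/eqP->|/IHs]; first exact: leq_addr.
by move=> h; apply: leq_trans h _; exact: leq_addl.
Qed.

Lemma size_leq_sumn (s : seq nat) : 0 \notin s -> size s <= sumn s.
Proof.
elim: s => //= y s IHs; rewrite in_cons negb_or => /andP[y0 /IHs h].
by rewrite -add1n leq_add // lt0n eq_sym.
Qed.

Lemma sp_size1 L : size L.1 = m.
Proof. by case/and5P: (superpartP L) => /eqP. Qed.

Lemma sp_sumn L : sumn L.1 + sumn L.2 = n.
Proof. by case/and5P: (superpartP L) => _ _ _ _ /eqP. Qed.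

Lemma sp_size2 L : size L.2 <= n.
Proof.
case/and5P: (superpartP L) => _ _ _ /size_leq_sumn h _.
by apply: leq_trans h _; rewrite -[X in _ <= X](sp_sumn L) leq_addl.
Qed.

Lemma sp_le1 L x : x \in L.1 -> x <= n.
Proof.
by move/mem_leq_sumn => h; apply: leq_trans h _; rewrite -[X in _ <= X](sp_sumn L) leq_addr.
Qed.

Lemma sp_le2 L x : x \in L.2 -> x <= n.
Proof.
by move/mem_leq_sumn => h; apply: leq_trans h _; rewrite -[X in _ <= X](sp_sumn L) leq_addl.
Qed.

Definition sp_enc L : m.-bseq 'I_n.+1 * n.-bseq 'I_n.+1 :=
  (insub_bseq m (map inord L.1), insub_bseq n (map inord L.2)).

Definition sp_dec (p : m.-bseq 'I_n.+1 * n.-bseq 'I_n.+1) :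
    option (superpart n m) :=
  insub (map val p.1, map val p.2).

Lemma inordK_map (s : seq nat) : (forall x, x \in s -> x <= n) ->
  map val (map (@inord n) s) = s.
Proof.
move=> h; rewrite -map_comp -[RHS]map_id; apply/eq_in_map => x /h xn /=.
by rewrite inordK.
Qed.

Lemma sp_encK : pcancel sp_enc sp_dec.
Proof.
move=> L; rewrite /sp_dec /= !val_insubd !size_map sp_size1 leqnn sp_size2.
rewrite !inordK_map; [|exact: sp_le2|exact: sp_le1].
by rewrite -surjective_pairing; exact: valK.
Qed.

End SuperpartFinite.

HB.instance Definition _ n m : isFinite (superpart n m) :=
  PCanIsFinite (@sp_encK n m).

Definition row_ge (r r' : nat * bool) : bool :=
  (r'.1 < r.1) || (r.1 == r'.1) && (r'.2 ==> r.2).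

(* The rows from top to bottom, as (number of boxes, circled?). *)
Definition sp_rows (p : seq nat * seq nat) : seq (nat * bool) :=
  sort row_ge ([seq (k, true) | k <- p.1] ++ [seq (k, false) | k <- p.2]).

Definition sp_row (p : seq nat * seq nat) (i : nat) : nat * bool :=
  nth (0, false) (sp_rows p) i.

(* Rows [i] and columns [j] are numbered from 0. *)
Definition has_box (p : seq nat * seq nat) (i j : nat) : bool :=
  j < (sp_row p i).1.

Definition has_circle (p : seq nat * seq nat) (i j : nat) : bool :=
  (sp_row p i).2 && (j == (sp_row p i).1).

Definition transposed (p q : seq nat * seq nat) : Prop :=
  forall i j, has_box q i j = has_box p j i /\ has_circle q i j = has_circle p j i.

Lemma row_ge_trans : transitive row_ge.
Proof.
move=> [y b] [x a] [z c]; rewrite /row_ge /=.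
case: (ltngtP y x) => [yx _|//|->] /=.
  by case: (ltngtP z y) => [zy _|//|-> _]; rewrite ?yx // (ltn_trans zy yx).
by case: (ltngtP z x) => //=; case: a b c => [] [] [].
Qed.

Lemma row_ge_anti : antisymmetric row_ge.
Proof.
by move=> [x a] [y b]; rewrite /row_ge /=; case: (ltngtP x y) => //= ->;
  case: a b => [] [].
Qed.

Lemma row_ge_total : total row_ge.
Proof.
by move=> [x a] [y b]; rewrite /row_ge /=; case: (ltngtP x y) => //=;
  case: a b => [] [].
Qed.

Definition sp_entries (p : seq nat * seq nat) : seq nat := p.1 ++ p.2.

Lemma perm_sp_rows p : perm_eq (map fst (sp_rows p)) (sp_entries p).
Proof.
have /permPl h := perm_sort row_ge
  ([seq (k, true) | k <- p.1] ++ [seq (k, false) | k <- p.2]).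
have := perm_map fst h; rewrite map_cat -!map_comp.
by rewrite (@eq_map _ _ (fst \o _) id) // (@eq_map _ _ (fst \o (fun k => (k, false))) id) // !map_id.
Qed.

Lemma sp_rows_sorted p : sorted row_ge (sp_rows p).
Proof. exact: sort_sorted row_ge_total _. Qed.

Lemma sp_rows_geq p : sorted geq (map fst (sp_rows p)).
Proof.
rewrite sorted_map; apply: sub_sorted (sp_rows_sorted p) => -[x a] [y b] /=.
by rewrite /row_ge /=; case: (ltngtP x y).
Qed.

Lemma geq_trans : transitive geq.
Proof. by move=> y x z /= yx zy; exact: leq_trans zy yx. Qed.

Lemma count_ltn0 (s : seq nat) i : (forall x, x \in s -> x <= i) ->
  count (ltn i) s = 0.
Proof.
move=> h; rewrite (@eq_in_count _ _ pred0) ?count_pred0 // => x /h xi /=.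
by rewrite ltnNge xi.
Qed.

Lemma nth_sorted_count (s : seq nat) i j : sorted geq s ->
  (i < nth 0 s j) = (j < count (ltn i) s).
Proof.
elim: s j => [|x s IHs] j; first by rewrite nth_nil.
rewrite /= (path_sortedE geq_trans) => /andP[/allP xs sS].
case: (ltnP i x) => ix.
  by case: j => [|j] /=; rewrite ?ix // IHs.
have -> : count (ltn i) s = 0.
  by apply: count_ltn0 => y /xs /= yx; exact: leq_trans yx ix.
case: j => [|j] /=; first by rewrite ltnNge ix.
rewrite IHs // count_ltn0 // => y /xs /= yx; exact: leq_trans yx ix.
Qed.

(* The default row is the smallest one, so dropping it from a sorted list does
   not change the rows seen by [nth]. *)
Lemma nth_filter_row (s : seq (nat * bool)) i : sorted row_ge s ->
  nth (0, false) [seq r <- s | r != (0, false)] i = nth (0, false) s i.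
Proof.
elim: s i => [|r s IHs] i //=.
rewrite (path_sortedE row_ge_trans) => /andP[/allP rs sS].
case: (altP (r =P (0, false))) => [r0|_]; last by case: i => //= i; rewrite IHs.
have s0 x : x \in s -> x = (0, false).
  move/rs; rewrite r0; case: x => [[|x] []] //.
rewrite (@eq_in_filter _ _ pred0) ?filter_pred0 ?nth_nil; last first.
  by move=> x /s0 ->; rewrite eqxx.
case: i => [|i] /=; first by rewrite r0.
case: (ltnP i (size s)) => h; last by rewrite nth_default.
by rewrite (s0 _ (mem_nth (0, false) h)).
Qed.

Lemma nth_sorted_row (s : seq (nat * bool)) i j : sorted row_ge s ->
  count_mem (j, true) s <= 1 ->
  (nth (0, false) s i == (j, true)) =
  ((j, true) \in s) && (i == count (fun r => j < r.1) s).
Proof.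
elim: s i => [|r s IHs] i; first by rewrite nth_nil xpair_eqE andbF.
rewrite /= (path_sortedE row_ge_trans) => /andP[/allP rs sS].
rewrite in_cons [(j, true) == r]eq_sym; case: (altP (r =P (j, true))) => [rE|nr].
  rewrite /= add1n ltnS leqn0 => /eqP c0.
  have /count_memPn js := c0.
  have -> : count (fun r0 : nat * bool => j < r0.1) s = 0.
    rewrite (@eq_in_count _ _ pred0) ?count_pred0 // => x /rs.
    by rewrite rE /row_ge /=; case: ltngtP.
  rewrite rE /= ltnn addn0.
  case: i => [|i] /=; first by rewrite eqxx.
  case: (ltnP i (size s)) => h; last by rewrite nth_default // xpair_eqE andbF.
  by apply/eqP => e; move: js; rewrite -e mem_nth.
rewrite add0n => c1 /=; case: i => [|i] /=.
  rewrite (negbTE nr); case: (boolP ((j, true) \in s)) => //= /rs.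
  by move: nr; case: r rs => x b _; rewrite /row_ge /= xpair_eqE; case: ltngtP => //= ->; case: b.
rewrite IHs //; case: (boolP ((j, true) \in s)) => //= /rs.
move: nr; case: r rs => x b _; rewrite /row_ge /= xpair_eqE.
by case: ltngtP => //= ->; case: b.
Qed.

Section Conjugate.
Variables (n m : nat) (L : superpart n m).
Variable cols : seq nat.
Hypothesis colsE : cols = iota 0 n.+1.
Let E := sp_entries L.
Let f j := count (ltn j) E.

Lemma sp_entries_le x : x \in E -> x <= n.
Proof. by rewrite mem_cat => /orP[/sp_le1|/sp_le2]. Qed.

Lemma sp_uniq1 : uniq L.1.
Proof.
case/and5P: (superpartP L) => _ h _ _ _; apply: sorted_uniq h => //.
- by move=> y x z /= yx zy; exact: ltn_trans zy yx.
- by move=> x; rewrite /= ltnn.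
Qed.

Definition conj_val : seq nat * seq nat :=
  (rev [seq f j | j <- L.1],
   [seq c <- [seq f j | j <- cols & j \notin L.1] | c != 0]).

Lemma count_leq_homo i j : i <= j -> f j <= f i.
Proof. by move=> ij; apply: sub_count => x /=; exact: leq_ltn_trans. Qed.

Lemma count_ltn_homo i j : i < j -> j \in E -> f j < f i.
Proof.
move=> ij jE; rewrite /f !(seq.permP (perm_to_rem jE)) /= ltnn ij add0n add1n ltnS.
by apply: sub_count => x /=; exact: ltn_trans.
Qed.

Lemma perm_conj1 : perm_eq L.1 [seq j <- cols | j \in L.1].
Proof.
apply: uniq_perm; rewrite ?sp_uniq1 ?filter_uniq ?colsE ?iota_uniq // => x.
rewrite mem_filter mem_iota /= add0n ltnS.
by case: (boolP (x \in L.1)) => //= /sp_le1.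
Qed.

Lemma sum_count_ltn (s : seq nat) N : (forall x, x \in s -> x <= N) ->
  \sum_(j <- iota 0 N) count (ltn j) s = sumn s.
Proof.
elim: s => [|x s IHs] h /=; first by rewrite big1_seq.
rewrite big_split /= IHs; last by move=> y ys; apply: h; rewrite in_cons ys orbT.
congr (_ + _); have xN : x <= N by apply: h; rewrite mem_head.
rewrite -[N](subnKC xN) iotaD big_cat /= [X in _ + X]big1_seq ?addn0.
  rewrite (eq_big_seq (fun=> 1)) ?big_const_seq ?count_predT ?size_iota ?iter_addn_0 ?mul1n //.
  by move=> i; rewrite mem_iota /= add0n => ->.
by move=> i /=; rewrite mem_iota add0n => /andP[xi _]; rewrite ltnNge xi.
Qed.

Lemma conj_valP : is_superpart n m conj_val.
Proof.
have [/eqP s1 s2 s3 s4 s5] := and5P (superpartP L).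
apply/and5P; split.
- by rewrite size_rev size_map s1.
- rewrite rev_sorted sorted_map.
  have h : {in [in L.1] &, subrel gtn (relpre f (fun y x => x > y))}.
    by move=> x y xL yL /= xy; apply: count_ltn_homo => //; rewrite mem_cat xL.
  by apply: (sub_in_sorted h) s2; apply/allP.
- apply: (sorted_filter geq_trans).
  rewrite sorted_map; apply: (@sub_sorted _ ltn).
    by move=> i j /= ij; exact/count_leq_homo/ltnW.
  by apply: sorted_filter; [exact: ltn_trans|rewrite colsE; exact: iota_ltn_sorted].
- by rewrite mem_filter eqxx.
- have nz (s : seq nat) : sumn [seq c <- s | c != 0] = sumn s.
    by elim: s => //= -[|c] s /= ->.
  rewrite /conj_val /= sumn_rev nz !sumn_map (perm_big _ perm_conj1).
  rewrite !big_filter.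
  have h : \sum_(j <- cols) f j = n.
    rewrite colsE sum_count_ltn ?sumn_cat ?sp_sumn //.
    by move=> x /sp_entries_le /leqW.
  apply/eqP; rewrite -[RHS]h [RHS](bigID (fun j => j \in L.1)) /=; congr (_ + _).
Qed.

Lemma conj_rows : sp_rows conj_val =
  [seq r <- [seq (f j, j \in L.1) | j <- cols] | r != (0, false)].
Proof.
apply: (sorted_eq row_ge_trans row_ge_anti); first exact: sp_rows_sorted.
  apply: (sorted_filter row_ge_trans); rewrite sorted_map.
  apply: (@sub_in_sorted _ [in cols] ltn); last by rewrite colsE; exact: iota_ltn_sorted.
    move=> i j _ _ /= ij; rewrite /row_ge /=.
    have := count_leq_homo (ltnW ij); rewrite leq_eqVlt => /orP[/eqP e|->] //.
    rewrite e eqxx; case: (boolP (j \in L.1)) => [jL|_]; last by rewrite orbT.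
    have : f j < f i by apply: count_ltn_homo => //; rewrite mem_cat jL.
    by rewrite e ltnn.
  by apply/allP.
rewrite /sp_rows; have /permPl h := perm_sort row_ge
  ([seq (k, true) | k <- conj_val.1] ++ [seq (k, false) | k <- conj_val.2]).
apply: perm_trans h _.
rewrite perm_sym -(perm_filterC (fun r => r.2)) perm_sym; apply: perm_cat.
  rewrite -filter_predI filter_map (@eq_filter _ (preim _ _) [in L.1]); last first.
    by move=> j /=; case: (j \in L.1) => //=; rewrite xpair_eqE andbF.
  rewrite /= map_rev perm_rev -map_comp.
  have /permPl -> := perm_map ((fun k => (k, true)) \o f) perm_conj1.
  set s := seq.filter _ _.
  suff -> : map ((fun k => (k, true)) \o f) s = [seq (f j, j \in L.1) | j <- s].
    exact: perm_refl.
  by apply/eq_in_map => j; rewrite mem_filter => /andP[jL _] /=; rewrite jL.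
rewrite /= -filter_predI !filter_map -map_comp -filter_predI.
set s := seq.filter _ cols; set t := seq.filter _ cols.
have -> : t = s.
  apply: eq_filter => j /=; rewrite xpair_eqE.
  by case: (j \in L.1); rewrite ?andbF ?andbT.
suff -> : map ((fun k => (k, false)) \o f) s = [seq (f j, j \in L.1) | j <- s].
  exact: perm_refl.
apply/eq_in_map => j; rewrite mem_filter /= => /andP[/andP[_ /negbTE jL] _].
by rewrite jL.
Qed.

Lemma conj_row i : sp_row conj_val i = (f i, i \in L.1).
Proof.
rewrite /sp_row conj_rows nth_filter_row; last first.
  rewrite sorted_map; apply: (@sub_in_sorted _ [in cols] ltn).
  - move=> k j _ _ /= ij; rewrite /row_ge /=.
    have := count_leq_homo (ltnW ij); rewrite leq_eqVlt => /orP[/eqP e|->] //.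
    rewrite e eqxx; case: (boolP (j \in L.1)) => [jL|_]; last by rewrite orbT.
    have : f j < f k by apply: count_ltn_homo => //; rewrite mem_cat jL.
    by rewrite e ltnn.
  - by apply/allP.
  - by rewrite colsE; exact: iota_ltn_sorted.
case: (ltnP i n.+1) => i_n.
  by rewrite colsE (nth_map 0) ?size_iota // nth_iota.
rewrite nth_default ?colsE ?size_map ?size_iota //; congr (_, _).
  by rewrite /f count_ltn0 // => x /sp_entries_le h; exact: leq_trans h (ltnW i_n).
by apply/esym/negbTE/negP => /sp_le1; rewrite leqNgt i_n.
Qed.

End Conjugate.

Lemma nth_fst (s : seq (nat * bool)) j :
  (nth (0, false) s j).1 = nth 0 (map fst s) j.
Proof. by elim: s j => [|r s IHs] [|j] //=. Qed.

Lemma perm_sp_rows' p : perm_eq (sp_rows p)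
  ([seq (k, true) | k <- p.1] ++ [seq (k, false) | k <- p.2]).
Proof. by apply/permPl/perm_sort. Qed.

Lemma mem_sp_rows p k b : ((k, b) \in sp_rows p) = (k \in if b then p.1 else p.2).
Proof.
have inj (c : bool) : injective (fun k : nat => (k, c)) by move=> x y [].
rewrite (perm_mem (perm_sp_rows' p)) mem_cat; case: b.
  rewrite (mem_map (inj true)) orbC; case: mapP => [[] //|//].
by rewrite (mem_map (inj false)); case: mapP => [[] //|//].
Qed.

Lemma conj_ex n m (L : superpart n m) :
  exists L' : superpart n m, transposed L L'.
Proof.
exists (Superpart (conj_valP L (erefl _))) => i j.
rewrite /has_box /has_circle /= (conj_row _ (erefl _)) /=; split.
  rewrite /sp_row nth_fst nth_sorted_count ?sp_rows_geq //.
  by rewrite (seq.permP (perm_sp_rows L)).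
transitivity (sp_row L j == (i, true)); last first.
  by case: (sp_row L j) => x [] /=; rewrite xpair_eqE ?andbT ?andbF // eq_sym.
rewrite nth_sorted_row ?sp_rows_sorted //; last first.
  rewrite (seq.permP (perm_sp_rows' L)) count_cat !count_map.
  rewrite (@eq_count _ _ (pred1 i)); last first.
    by move=> k; rewrite /= xpair_eqE andbT.
  rewrite (@eq_count _ (preim (fun k => (k, false)) _) pred0); last first.
    by move=> k; rewrite /= xpair_eqE andbF.
  by rewrite count_pred0 addn0 count_uniq_mem ?leq_b1 // sp_uniq1.
rewrite mem_sp_rows -(seq.permP (perm_sp_rows L) (ltn i)) count_map.
by congr (_ && (_ == _)).
Qed.

(* A superpartition is determined by its diagram. *)
Lemma sp_diagram_inj n m (L L' : superpart n m) :
  (forall i j, has_box L i j = has_box L' i j /\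
               has_circle L i j = has_circle L' i j) -> L = L'.
Proof.
move=> h.
have rowE i : sp_row L i = sp_row L' i.
  have e1 : (sp_row L i).1 = (sp_row L' i).1.
    apply/eqP; rewrite eqn_leq; apply/andP; split; rewrite leqNgt; apply/negP => lt.
      by have [] := h i (sp_row L' i).1; rewrite /has_box lt ltnn.
    by have [] := h i (sp_row L i).1; rewrite /has_box lt ltnn.
  have [_] := h i (sp_row L i).1; rewrite /has_circle {3}e1 !eqxx !andbT => e2.
  by rewrite [LHS]surjective_pairing e1 e2 -surjective_pairing.
have nz (K : superpart n m) : (0, false) \notin sp_rows K.
  by rewrite mem_sp_rows; case/and5P: (superpartP K).
have le (K K' : superpart n m) : (forall i, sp_row K i = sp_row K' i) ->
    size (sp_rows K) <= size (sp_rows K').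
  move=> e; rewrite leqNgt; apply/negP => lt; have := e (size (sp_rows K')).
  rewrite /sp_row [RHS]nth_default // => e0.
  by move: (nz K); rewrite -e0 mem_nth.
have rE : sp_rows L = sp_rows L'.
  apply: (@eq_from_nth _ (0, false)) => [|i _]; last exact: rowE.
  by apply/eqP; rewrite eqn_leq !le.
have pE (K : superpart n m) b : perm_eq [seq r.1 | r <- sp_rows K & r.2 == b]
                    (if b then K.1 else K.2).
  apply: perm_trans (perm_map fst (perm_filter (fun r => r.2 == b) (perm_sp_rows' K))) _.
  rewrite filter_cat !filter_map map_cat -!map_comp /=.
  by case: b; rewrite filter_predT filter_pred0 /= ?cats0 map_id; exact: perm_refl.
have pL b : perm_eq (if b then L.1 else L.2) (if b then L'.1 else L'.2).
  by rewrite -(permPl (pE L b)) rE; exact: pE.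
have anti : antisymmetric geq.
  by move=> x y /= h'; apply/eqP; rewrite eqn_leq andbC.
have [_ s1 s2 _ _] := and5P (superpartP L).
have [_ t1 t2 _ _] := and5P (superpartP L').
have gt_geq (s : seq nat) : sorted gtn s -> sorted geq s.
  by apply: sub_sorted => x y; exact: ltnW.
apply: val_inj; rewrite /= [LHS]surjective_pairing [RHS]surjective_pairing.
congr (_, _); last exact: (sorted_eq geq_trans anti s2 t2 (pL false)).
exact: (sorted_eq geq_trans anti (gt_geq _ s1) (gt_geq _ t1) (pL true)).
Qed.

Definition sp_conj n m (L : superpart n m) : superpart n m :=
  projT1 (cid (conj_ex L)).

Lemma sp_conjP n m (L : superpart n m) : transposed L (sp_conj L).
Proof. exact: projT2 (cid (conj_ex L)). Qed.

Lemma sp_conj_unique n m (L L' : superpart n m) :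
  transposed L L' -> L' = sp_conj L.
Proof.
move=> h; apply: sp_diagram_inj => i j.
by have [-> ->] := h i j; have [-> ->] := sp_conjP L i j.
Qed.

Section Bruhat.
Variable N : nat.
Implicit Types (u v w : 'S_N) (l k : N.-tuple nat).

Definition perm_length w : nat :=
  #|[set p : 'I_N * 'I_N | (p.1 < p.2) && (w p.2 < w p.1)]|.

(* The reflexive transitive closure of u < tu for t a transposition and
   perm_length u < perm_length (tu); the transposition may equivalently be
   put on the other side. *)
Definition bruhat_le : rel 'S_N :=
  connect [rel u v | [exists i, exists j, v == (u * tperm i j)%g] &&
                     (perm_length u < perm_length v)].

Definition decr l : N.-tuple nat := sort_tuple geq l.

(* l = w l^+, where (w k)_(w i) = k_i. *)
Definition sorts_to w l : bool :=
  [forall i, tnth l (w i) == tnth (decr l) i].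

Definition min_perm l : 'S_N :=
  odflt 1%g [pick w | sorts_to w l &
    [forall v, sorts_to v l ==> (perm_length w <= perm_length v)]].

Definition dominated l k : bool :=
  (sumn l == sumn k) && [forall i : 'I_N.+1, sumn (take i l) <= sumn (take i k)].

Definition comp_le l k : bool :=
  (decr l != decr k) && dominated (decr l) (decr k) ||
  (decr l == decr k) && bruhat_le (min_perm k) (min_perm l).
End Bruhat.

Lemma size_sp_comp n m (L : superpart n m) : size (L.1 ++ L.2) <= m + n.
Proof. by rewrite size_cat sp_size1 leq_add2l sp_size2. Qed.

(* Padding all superpartitions of (n|m) to length m + n; the order does not
   depend on the choice of a common length. *)
Definition sp_comp n m (L : superpart n m) : (m + n).-tuple nat :=
  [tuple nth 0 (L.1 ++ L.2) i | i < m + n].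

Definition sp_le n m (O L : superpart n m) : bool :=
  comp_le (sp_comp O) (sp_comp L).

Definition sp_lt n m (O L : superpart n m) : bool := (O != L) && sp_le O L.

(* (S, a) stands for theta_(i_1) ... theta_(i_k) x^a, where i_1 < ... < i_k are
   the elements of S and a i is the exponent of x_i; indices start at 0. *)
Definition smonom : Type := ({fset nat} * {mset nat}%mset)%type.
HB.instance Definition _ := Choice.on smonom.

Notation superseries := (smonom -> int).

(* theta_S theta_T = (-1)^(cross_inv S T) theta_(S U T) for disjoint S and T. *)
Definition cross_inv (S T : {fset nat}) : nat :=
  \sum_(i <- S) \sum_(j <- T) (j < i).

Definition factors (M : smonom) : set (smonom * smonom) :=
  [set PQ | [/\ [disjoint PQ.1.1 & PQ.2.1]%fset,
                (PQ.1.1 `|` PQ.2.1)%fset = M.1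
              & (PQ.1.2 `+` PQ.2.2)%mset = M.2]]%classic.

Lemma finite_factors M : finite_set (factors M).
Proof.
pose D : {fset smonom} := [fset (A, seq_mset (mask (val b) M.2)) |
  A in fpowerset M.1, b in {: (size M.2).-tuple bool}]%fset.
have inD A (B C : {mset nat}%mset) : (A `<=` M.1)%fset -> (B `+` C)%mset = M.2 ->
    (A, B) \in D.
  move=> AM BC; have /count_subseqP[t /subseqP[b bs ->] /eq_seq_msetP] :
      forall x, count_mem x B <= count_mem x M.2.
    by move=> x; rewrite !count_mem_mset -BC msetE2 leq_addr.
  rewrite seq_mset_id => ->; apply/imfset2P; exists A; first by rewrite fpowersetE.
  by exists (Tuple (introT eqP bs)).
apply: (sub_finite_set (B := [set` D] `*` [set` D]))%classic; last first.
  by apply: finite_setX; exact: finite_fset.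
move=> [[A B] [C E]] [/= _ AC BE]; split => /=; first last.
  by apply: (inD _ _ B); rewrite -?AC ?fsubsetUr // msetDC.
by apply: (inD _ _ E); rewrite -?AC ?fsubsetUl.
Qed.

Definition sone : superseries := fun M => ((M == (fset0, mset0)) : nat)%:Z%R.

Definition smul (f g : superseries) : superseries := fun M =>
  (\sum_(PQ \in factors M)
     (-1) ^+ cross_inv PQ.1.1 PQ.2.1 * (f PQ.1 * g PQ.2))%R.

Definition finitary_perm (s : nat -> nat) : Prop :=
  bijective s /\ exists N, forall i, N <= i -> s i = i.

(* [moves s M b M']: replacing each (x_i, theta_i) by (x_(s i), theta_(s i))
   turns the monomial M into (-1)^b M'. *)
Definition moves (s : nat -> nat) (M : smonom) (b : bool) (M' : smonom) : Prop :=
  [/\ M'.1 = [fset s i | i in M.1]%fset,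
      forall i, M'.2 (s i) = M.2 i
    & b = odd (\sum_(i <- M.1) \sum_(j <- M.1 | i < j) (s j < s i))].

Definition homogeneous (n m : nat) (f : superseries) : Prop :=
  forall M, f M != 0%R -> size M.2 = n /\ #|` M.1| = m.

Definition perm_invariant (f : superseries) : Prop :=
  forall s M b M', finitary_perm s -> moves s M b M' ->
    f M' = ((-1) ^+ b * f M)%R.

Definition symsuper (n m : nat) : set superseries :=
  [set f | homogeneous n m f /\ perm_invariant f]%classic.

(* theta_1 ... theta_m x_1^(L_1) x_2^(L_2) ... *)
Definition sp_monom n m (L : superpart n m) : smonom :=
  ([fset i in iota 0 m]%fset,
   seq_mset (flatten [seq nseq (nth 0 (L.1 ++ L.2) i) i
                     | i <- iota 0 (size (L.1 ++ L.2))])).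

(* [in_orbit L b M]: (-1)^b M is one of the terms obtained from sp_monom L. *)
Definition in_orbit n m (L : superpart n m) (b : bool) (M : smonom) : Prop :=
  exists2 s, finitary_perm s & moves s (sp_monom L) b M.

(* The coefficient of M in the sum of all distinct terms of the orbit. *)
Definition msuper n m (L : superpart n m) : superseries := fun M =>
  ((`[< in_orbit L false M >] : nat)%:Z - (`[< in_orbit L true M >] : nat)%:Z)%R.

(* x^a is a product of distinct variables iff the multiset a is duplicate-free. *)
Definition esuper (n : nat) : superseries := fun M =>
  ([&& M.1 == fset0, uniq M.2 & size M.2 == n] : nat)%:Z%R.

Definition etilde (n : nat) : superseries := fun M =>
  ([&& #|` M.1| == 1%N, uniq M.2, size M.2 == n & all [predC M.1] M.2] : nat)%:Z%R.

Definition eprod (a s : seq nat) : superseries :=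
  smul (\big[smul/sone]_(k <- a) etilde k) (\big[smul/sone]_(k <- s) esuper k).

Definition e_sp n m (L : superpart n m) : superseries := eprod L.1 L.2.

Definition e_sp_rev n m (L : superpart n m) : superseries := eprod (rev L.1) L.2.

Definition Zbasis (V : zmodType) (P : set V) (I : finType) (b : I -> V) : Prop :=
  [/\ forall i, P (b i),
      forall c : I -> int, (\sum_i b i *~ c i = 0)%R -> forall i, c i = 0%R
    & forall v, P v -> exists c : I -> int, (v = \sum_i b i *~ c i)%R].

Lemma symsuper_zmod n m : zmod_closed (fun f : superseries => `[< symsuper n m f >]).
Proof.
split=> [|f g /asboolP[hf sf] /asboolP[hg sg]]; apply/asboolP; split.
- by move=> M; rewrite eqxx.
- by move=> s M b M' _ _; rewrite mulr0.
- move=> M; case: (eqVneq (f M) 0%R) => [f0|/hf//].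
  by case: (eqVneq (g M) 0%R) => [g0|/hg//]; rewrite /GRing.add /= /GRing.opp /= f0 g0.
- move=> s M b M' hs hM; rewrite mulrBr.
  by rewrite -(sf _ _ _ _ hs hM) -(sg _ _ _ _ hs hM).
Qed.

(* Main.v *)
Require Import Defs.
From mathcomp Require Import all_boot all_order all_fingroup all_algebra.
From mathcomp Require Import finmap multiset.
From mathcomp Require Import all_classical.
From mathcomp Require Import zify.

Set Implicit Arguments.
Unset Strict Implicit.
Unset Printing Implicit Defensive.

Import GRing.Theory.

Local Open Scope nat_scope.

(* Expanding a product of elementary superfunctions, a coefficient is a
   signed count of 0/1 fillings of the rows of L in which each circled row also carries a circle in
   an empty column. Any k columns receive at most the sum of min(L_i, k) boxes;
   this is dominance, and equality for all k forces the left-justified filling.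
   The circle of a row of length L_i then lies in a column of index at least
   L_i, which is the Bruhat comparison for the Grassmannian-type permutations
   sorting the compositions, and the conjugate diagram itself arises exactly
   once. As only coefficients are compared, associativity and anticommutation of
   the products are not needed: reversing the order of the fermionic factors
   still gives coefficient 1 or -1 at the conjugate, so both families are
   triangular in the monomial basis. *)

(** * Degrees and supports of products of superfunctions *)

Lemma perm_fsetU (A B : {fset nat}) : [disjoint A & B]%fset ->
  perm_eq (A `|` B)%fset (A ++ B).
Proof.
move=> AB; apply: uniq_perm; rewrite ?fset_uniq //.
  rewrite cat_uniq !fset_uniq andbT /=; apply/hasPn => x xB.
  by apply/negP => xA; move/fdisjointP: AB => /(_ _ xA) /negP; apply.
by move=> x; rewrite mem_cat in_fsetU.
Qed.

Lemma perm_msetD (A B : {mset nat}%mset) : perm_eq (A `+` B)%mset (A ++ B).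
Proof.
by apply/allP => x _ /=; rewrite count_cat !count_mem_mset msetE2.
Qed.

Lemma perm_fset_seq (a : seq nat) : uniq a -> perm_eq [fset i in a]%fset a.
Proof.
by move=> ua; apply: uniq_perm; rewrite ?fset_uniq // => x; rewrite inE.
Qed.

Lemma perm_fset1 (c : nat) : perm_eq [fset c]%fset [:: c].
Proof. by apply: uniq_perm; rewrite ?fset_uniq // => x; rewrite !inE. Qed.

Lemma natz_bool_neq0 (b : bool) : ((b : nat)%:Z != 0)%R -> b.
Proof. by case: b; rewrite ?eqxx. Qed.

Lemma smul_neq0 f g M : smul f g M != 0%R ->
  exists PQ, [/\ factors M PQ, f PQ.1 != 0%R & g PQ.2 != 0%R].
Proof.
move=> /(@fsbigN1 _ _ _ unit _ _ (fun _ PQ => _) tt)[PQ facPQ /=].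
by rewrite !mulf_eq0 !negb_or => /and3P[_ fP gQ]; exists PQ.
Qed.

(** Leading coefficients are computed through this collapse of the convolution sum to a single
    factorization. *)
Lemma smul_unique f g M P Q : factors M (P, Q) ->
  (forall P' Q', factors M (P', Q') -> f P' != 0%R -> g Q' != 0%R ->
     P' = P /\ Q' = Q) ->
  smul f g M = ((-1) ^+ cross_inv P.1 Q.1 * (f P * g Q))%R.
Proof.
move=> facM uniq; rewrite /smul (fsbigD1 (P, Q)) //=; last exact: finite_factors.
rewrite fsbig1 ?addr0 // => -[P' Q'] [fac' ne].
have [f0|nf] := eqVneq (f P') 0%R; first by rewrite f0 mul0r mulr0.
have [g0|ng] := eqVneq (g Q') 0%R; first by rewrite g0 mulr0 mulr0.
by case: ne; have [-> ->] := uniq _ _ fac' nf ng.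
Qed.

Lemma homogeneous_smul n m n' m' f g :
  homogeneous n m f -> homogeneous n' m' g ->
  homogeneous (n + n') (m + m') (smul f g).
Proof.
move=> hf hg M /smul_neq0[[P Q] [[/= dPQ <- <-] /hf[<- <-] /hg[<- <-]]].
by rewrite (perm_size (perm_msetD _ _)) (perm_size (perm_fsetU dPQ)) !size_cat.
Qed.

Lemma homogeneous_sone : homogeneous 0 0 sone.
Proof.
move=> M /natz_bool_neq0/eqP->.
by split; rewrite /= ?enum_mset0 ?enum_fset0.
Qed.

Lemma homogeneous_etilde k : homogeneous k 1 (etilde k).
Proof. by move=> M /natz_bool_neq0/and4P[/eqP-> _ /eqP-> _]. Qed.

Lemma homogeneous_esuper k : homogeneous k 0 (esuper k).
Proof.
by move=> M /natz_bool_neq0/and3P[/eqP-> _ /eqP->]; split.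
Qed.

Lemma homogeneous_eprod a s :
  homogeneous (sumn a + sumn s) (size a) (eprod a s).
Proof.
rewrite -[size a]addn0; apply: homogeneous_smul.
  elim: a => [|k a IH]; rewrite ?big_nil ?big_cons; first exact: homogeneous_sone.
  by have := homogeneous_smul (@homogeneous_etilde k) IH; rewrite add1n.
elim: s => [|k s IH]; rewrite ?big_nil ?big_cons; first exact: homogeneous_sone.
by have := homogeneous_smul (@homogeneous_esuper k) IH; rewrite add0n.
Qed.

(** * Extremal terms of products of elementary superfunctions *)

(* Here [r] lists row lengths and [a] the circled ones: a nonzero coefficient
   is a 0/1 filling of the rows, and [lmon r a] is the left-justified filling,
   with every circle at the end of its row. *)

Definition conj_mset (r : seq nat) : {mset nat}%mset :=
  seq_mset (flatten [seq iota 0 k | k <- r]).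

Definition lmon (r a : seq nat) : smonom := ([fset i in a]%fset, conj_mset r).

(** The number of boxes in the first [k] columns of left-justified rows [r]; no [k] columns of a 0/1
    filling can hold more. *)
Definition row_sum (r : seq nat) k := \sum_(i <- r) minn i k.

Definition circ_ge (S : seq nat) t := count (leq t) S.

(** All sets of columns are allowed, not only initial ones, because dominance is proved with the set
    of variables that carry the largest exponents. *)
Definition bounded (f : superseries) r := forall M t, f M != 0%R -> uniq t ->
  count (mem t) M.2 <= row_sum r (size t).

(** Positions of circles are compared by counting the circles at or beyond each column: such counts
    add under products, whereas sorted positions would have to be merged. *)
Definition circled (f : superseries) r a := forall M t, f M != 0%R ->
  M.2 = conj_mset r -> circ_ge a t <= circ_ge M.1 t.

Lemma row_sum_cat r r' k : row_sum (r ++ r') k = row_sum r k + row_sum r' k.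
Proof. by rewrite /row_sum big_cat. Qed.

Lemma conj_msetE r j : conj_mset r j = count (ltn j) r.
Proof.
rewrite /conj_mset mset_seqE count_flatten -map_comp.
elim: r => //= k r ->; congr (_ + _).
by rewrite count_uniq_mem ?iota_uniq // mem_iota.
Qed.

Lemma conj_mset_cat r r' :
  conj_mset (r ++ r') = (conj_mset r `+` conj_mset r')%mset.
Proof. by apply/msetP => j; rewrite msetE2 !conj_msetE count_cat. Qed.

Lemma count_mem_iotaS (A : {mset nat}%mset) k :
  count (mem (iota 0 k.+1)) A = count (mem (iota 0 k)) A + A k.
Proof.
rewrite -count_mem_mset -count_predUI [X in _ = _ + X](@eq_count _ _ pred0).
  rewrite count_pred0 addn0; apply: eq_count => x.
  rewrite -[LHS]/(x \in iota 0 k.+1) -[RHS]/((x \in iota 0 k) || (x == k)).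
  by rewrite !mem_iota; lia.
by move=> x /=; rewrite mem_iota add0n; case: eqP => [->|]; rewrite ?ltnn ?andbF.
Qed.

Lemma row_sumS r k : row_sum r k.+1 = row_sum r k + count (ltn k) r.
Proof.
rewrite /row_sum; elim: r => [|i r IH]; rewrite ?big_nil // !big_cons IH /=.
by case: ltnP => h /=; lia.
Qed.

Lemma conj_mset_row_sum r k : count (mem (iota 0 k)) (conj_mset r) = row_sum r k.
Proof.
elim: k => [|k IH]; last by rewrite count_mem_iotaS row_sumS IH conj_msetE.
by rewrite /= count_pred0 /row_sum big1 // => i _; rewrite minn0.
Qed.

(** Successive differences of the counts on initial segments of columns recover the exponents. *)
Lemma row_sum_conj_mset (A : {mset nat}%mset) r :
  (forall k, count (mem (iota 0 k)) A = row_sum r k) -> A = conj_mset r.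
Proof.
move=> h; apply/msetP => k; rewrite conj_msetE; apply: (@addnI (row_sum r k)).
by rewrite -row_sumS -!h count_mem_iotaS.
Qed.

Lemma perm_circ_ge (S T : seq nat) :
  (forall t, circ_ge S t = circ_ge T t) -> perm_eq S T.
Proof.
move=> h; apply/allP => t _ /=.
have E (U : seq nat) : circ_ge U t = circ_ge U t.+1 + count_mem t U.
  rewrite /circ_ge -count_predUI [X in _ = _ + X](@eq_count _ _ pred0).
    rewrite count_pred0 addn0; apply: eq_count => x /=.
    by rewrite leq_eqVlt eq_sym orbC.
  by move=> x /=; case: eqP => [->|]; rewrite ?ltnn ?andbF.
by apply/eqP; apply: (@addnI (circ_ge S t.+1)); rewrite -E h [in RHS]h E.
Qed.

Lemma leq_addn_eq x y a b : x + y = a + b -> x <= a -> y <= b -> x = a /\ y = b.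
Proof. lia. Qed.

(** On each initial segment of columns the bounds for the two factors add up to the count attained
    by the product, so both are equalities and each factor is left-justified. *)
Lemma bounded_split f g r r' P Q : bounded f r -> bounded g r' ->
  f P != 0%R -> g Q != 0%R -> (P.2 `+` Q.2)%mset = conj_mset (r ++ r') ->
  P.2 = conj_mset r /\ Q.2 = conj_mset r'.
Proof.
move=> bf bg fP gQ E.
have h k : count (mem (iota 0 k)) P.2 = row_sum r k /\
           count (mem (iota 0 k)) Q.2 = row_sum r' k.
  apply: leq_addn_eq; first 1 last.
  - by have := bf _ _ fP (iota_uniq 0 k); rewrite size_iota.
  - by have := bg _ _ gQ (iota_uniq 0 k); rewrite size_iota.
  by rewrite -row_sum_cat -conj_mset_row_sum -E (seq.permP (perm_msetD _ _)) count_cat.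
by split; apply: row_sum_conj_mset => k; have [] := h k.
Qed.

Lemma bounded_smul f g r r' :
  bounded f r -> bounded g r' -> bounded (smul f g) (r ++ r').
Proof.
move=> bf bg M t /smul_neq0[[P Q] [[/= dPQ _ <-] fP gQ]] ut.
rewrite (seq.permP (perm_msetD _ _)) count_cat row_sum_cat.
by apply: leq_add; [exact: bf|exact: bg].
Qed.

Lemma circled_smul f g r r' a a' : bounded f r -> bounded g r' ->
  circled f r a -> circled g r' a' -> circled (smul f g) (r ++ r') (a ++ a').
Proof.
move=> bf bg cf cg M t /smul_neq0[[P Q] [[/= dPQ <- <-] fP gQ]].
move=> /(bounded_split bf bg fP gQ)[rP rQ].
rewrite /circ_ge (seq.permP (perm_fsetU dPQ)) !count_cat.
by apply: leq_add; [exact: cf|exact: cg].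
Qed.

(** Equality in the column bounds fixes the exponents of both factors; then the two lower bounds on
    circle counts are also equalities and fix the circles. A single factorization survives, and its
    sign counts the pairs that concatenation puts out of order. *)
Lemma lmon_smul f g r r' a a' : bounded f r -> bounded g r' ->
  circled f r a -> circled g r' a' -> uniq (a ++ a') ->
  smul f g (lmon (r ++ r') (a ++ a')) =
  ((-1) ^+ (\sum_(i <- a) count (gtn i) a') * (f (lmon r a) * g (lmon r' a')))%R.
Proof.
move=> bf bg cf cg uaa; have /and3P[ua /hasPn daa ua'] := etrans (esym (cat_uniq _ _)) uaa.
rewrite (@smul_unique _ _ _ (lmon r a) (lmon r' a')).
- congr ((-1) ^+ _ * _)%R; rewrite /cross_inv /= (perm_big _ (perm_fset_seq ua)).
  apply: eq_bigr => i _; rewrite (perm_big _ (perm_fset_seq ua')) /=.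
  by rewrite -sum1_count [RHS]big_mkcond; apply: eq_bigr => j _ /=; case: (j < i).
- split=> /=; last by rewrite conj_mset_cat.
    apply/fdisjointP => x; rewrite !inE => xa; apply/negP => xa'.
    by move: (daa _ xa'); rewrite /= xa.
  by apply/fsetP => x; rewrite in_fsetU !inE.
move=> [S A] [T B] [/= dST ST AB] fP gQ.
have [/= -> ->] := bounded_split bf bg fP gQ AB.
have [/= EA EB] := bounded_split bf bg fP gQ AB.
have h t : circ_ge a t = circ_ge S t /\ circ_ge a' t = circ_ge T t.
  have [|||-> ->] // := @leq_addn_eq (circ_ge a t) (circ_ge a' t) (circ_ge S t) (circ_ge T t).
  - rewrite /circ_ge -!count_cat -(seq.permP (perm_fsetU dST)) ST.
    by rewrite (seq.permP (perm_fset_seq uaa)).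
  - exact: cf fP EA.
  - exact: cg gQ EB.
rewrite /lmon; split; congr (_, _); apply/fsetP => x; rewrite inE.
  by apply/esym/perm_mem/perm_circ_ge => t; have [] := h t.
by apply/esym/perm_mem/perm_circ_ge => t; have [] := h t.
Qed.

(** A row of length [k] has at most one box per column, hence at most [size t] boxes in the columns
    [t] and at most [k] in all. *)
Lemma bounded_uniq (f : superseries) k :
  (forall M, f M != 0%R -> uniq M.2 /\ size M.2 = k) -> bounded f [:: k].
Proof.
move=> h M t /h[uM sM] ut; rewrite /row_sum big_seq1 leq_min -{1}sM count_size.
rewrite -size_filter uniq_leq_size ?filter_uniq // => x.
by rewrite mem_filter => /andP[].
Qed.

Lemma sone_neq0 M : sone M != 0%R -> M = (fset0, mset0).
Proof. by move/natz_bool_neq0/eqP. Qed.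

Lemma bounded_sone : bounded sone [::].
Proof. by move=> M t /sone_neq0-> _; rewrite /= enum_mset0. Qed.

Lemma circled0 f r : circled f r [::].
Proof. by []. Qed.

Lemma lmon_sone : sone (lmon [::] [::]) = 1%R.
Proof.
rewrite /sone (_ : lmon _ _ = (fset0, mset0)) ?eqxx //; congr (_, _).
  by apply/fsetP => x; rewrite !inE.
by apply/msetP => j; rewrite conj_msetE mset0E.
Qed.

Lemma bounded_etilde k : bounded (etilde k) [:: k].
Proof.
by apply: bounded_uniq => M /natz_bool_neq0/and4P[_ -> /eqP-> _].
Qed.

Lemma bounded_esuper k : bounded (esuper k) [:: k].
Proof.
by apply: bounded_uniq => M /natz_bool_neq0/and3P[_ -> /eqP->].
Qed.

Lemma perm_conj_mset1 k : perm_eq (conj_mset [:: k]) (iota 0 k).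
Proof. by rewrite /conj_mset /= cats0; exact: perm_eq_seq_mset. Qed.

(** The boxes occupy all columns below [k], and the circle avoids every column that has a box. *)
Lemma circled_etilde k : circled (etilde k) [:: k] [:: k].
Proof.
move=> [S A] t /natz_bool_neq0/and4P[/= /cardfs1P[c ->] _ _ /allP h] EA.
rewrite /circ_ge (seq.permP (perm_fset1 c)) /= !addn0; case: (leqP t k) => // tk.
suff kc : k <= c by rewrite (leq_trans tk kc).
rewrite leqNgt; apply/negP => ck.
have /h : c \in A by rewrite EA (perm_mem (perm_conj_mset1 k)) mem_iota.
by rewrite /= inE eqxx.
Qed.

Lemma lmon_etilde k : etilde k (lmon [:: k] [:: k]) = 1%R.
Proof.
rewrite /etilde /= (perm_size (perm_fset_seq _)) // (perm_uniq (perm_conj_mset1 k)).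
rewrite (perm_size (perm_conj_mset1 k)) iota_uniq size_iota !eqxx /=.
suff -> : all [predC [fset i in [:: k]]%fset] (conj_mset [:: k]) by [].
apply/allP => x; rewrite (perm_mem (perm_conj_mset1 k)) mem_iota /= !inE.
by case: eqP => // ->; rewrite add0n ltnn.
Qed.

Lemma lmon_esuper k : esuper k (lmon [:: k] [::]) = 1%R.
Proof.
rewrite /esuper /= (perm_uniq (perm_conj_mset1 k)) (perm_size (perm_conj_mset1 k)).
rewrite iota_uniq size_iota eqxx /=; suff -> : [fset i in [::]]%fset = fset0 :> {fset nat} by rewrite eqxx.
by apply/fsetP => x; rewrite !inE.
Qed.

(** The number of inversions of [a], whose parity is the sign of sorting the product of the theta
    variables indexed by [a]. *)
Fixpoint seq_inv (a : seq nat) : nat :=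
  if a is x :: a' then count (gtn x) a' + seq_inv a' else 0.

Lemma seq_inv_sorted a : sorted ltn a -> seq_inv a = 0.
Proof.
elim: a => //= x a IH; rewrite (path_sortedE ltn_trans) => /andP[/allP xa /IH->].
rewrite addn0; apply/eqP; rewrite -leqn0 leqNgt -has_count; apply/hasPn => y /xa /=.
by rewrite -leqNgt; exact: ltnW.
Qed.

(** Splitting off the first factor contributes one sign for each later circle lying to its left,
    which is the recursion of [seq_inv]. *)
Lemma etildes_extremal a (f := \big[smul/sone]_(k <- a) etilde k) :
  [/\ bounded f a, circled f a a & uniq a -> f (lmon a a) = ((-1) ^+ seq_inv a)%R].
Proof.
rewrite /f {f}; elim: a => [|k a [b c l]]; rewrite ?big_nil ?big_cons.
  by split; [exact: bounded_sone|exact: circled0|rewrite lmon_sone].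
rewrite -cat1s; split.
- exact: bounded_smul (@bounded_etilde k) b.
- exact: circled_smul (@bounded_etilde k) b (@circled_etilde k) c.
- move=> ua; rewrite (lmon_smul (@bounded_etilde k) b (@circled_etilde k) c ua).
  by rewrite lmon_etilde mul1r big_seq1 l ?exprD //; case/andP: ua.
Qed.

Lemma esupers_extremal s (f := \big[smul/sone]_(k <- s) esuper k) :
  bounded f s /\ f (lmon s [::]) = 1%R.
Proof.
rewrite /f {f}; elim: s => [|k s [b l]]; rewrite ?big_nil ?big_cons.
  by split; [exact: bounded_sone|rewrite lmon_sone].
rewrite -cat1s; split; first exact: bounded_smul (@bounded_esuper k) b.
rewrite -[[::] in LHS]cats0 (lmon_smul (@bounded_esuper k) b (@circled0 _ _) (@circled0 _ _)) //.
by rewrite lmon_esuper l big_nil.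
Qed.

Lemma bounded_eprod a s : bounded (eprod a s) (a ++ s).
Proof.
by have [b _ _] := etildes_extremal a; have [b' _] := esupers_extremal s; exact: bounded_smul.
Qed.

Lemma circled_eprod a s : circled (eprod a s) (a ++ s) a.
Proof.
have [b c _] := etildes_extremal a; have [b' _] := esupers_extremal s.
by rewrite -[X in circled _ _ X]cats0; exact: circled_smul.
Qed.

Lemma lmon_eprod a s : uniq a ->
  eprod a s (lmon (a ++ s) a) = ((-1) ^+ seq_inv a)%R.
Proof.
move=> ua; have [b c l] := etildes_extremal a; have [b' l'] := esupers_extremal s.
rewrite /eprod -[X in lmon _ X]cats0 (lmon_smul b b' c (@circled0 _ _)) ?cats0 //.
by rewrite l // l' mulr1 big1 ?mul1r.
Qed.

(** * Invariance under simultaneous permutations *)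

(** Turns the relation [moves] into a function on monomials, with the sign kept apart in
    [inversions]. *)
Definition smact (s : nat -> nat) (M : smonom) : smonom :=
  ([fset s i | i in M.1]%fset, seq_mset (map s M.2)).

Definition inversions (s : nat -> nat) (S : seq nat) : nat :=
  \sum_(i <- S) \sum_(j <- S | i < j) (s j < s i).

Lemma perm_imfset (s : nat -> nat) (A : {fset nat}) : injective s ->
  perm_eq [fset s i | i in A]%fset (map s A).
Proof.
move=> sI; apply: uniq_perm; rewrite ?fset_uniq ?map_inj_uniq ?fset_uniq // => x.
by apply/imfsetP/mapP => -[i iA ->]; exists i.
Qed.

Lemma act_mset (s : nat -> nat) (M : smonom) : injective s ->
  forall i, (smact s M).2 (s i) = M.2 i.
Proof.
move=> sI i; rewrite mset_seqE count_map -count_mem_mset; apply: eq_count => j /=.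
by rewrite (inj_eq sI).
Qed.

Lemma movesE s M b M' : bijective s ->
  moves s M b M' <-> M' = smact s M /\ b = odd (inversions s M.1).
Proof.
move=> [s' sK s'K]; have sI := can_inj sK; split=> [[E1 E2 ->]|[-> ->]].
  split=> //; case: M' E1 E2 => S A /= -> E2; congr (_, _).
  by apply/msetP => x; rewrite -[x]s'K E2 (act_mset M sI).
by split=> // i; exact: act_mset.
Qed.

Lemma act_comp s s' (M : smonom) : injective s' -> smact s (smact s' M) = smact (s \o s') M.
Proof.
move=> sI; rewrite /smact; congr (_, _).
  by apply/fsetP => x; rewrite -imfset_comp.
by apply/eq_seq_msetP; rewrite map_comp perm_map // perm_eq_seq_mset.
Qed.

Lemma eq_act s s' (M : smonom) : s =1 s' -> smact s M = smact s' M.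
Proof.
move=> E; rewrite /smact (eq_map E); congr (_, _).
by apply/fsetP => x; apply/imfsetP/imfsetP => -[i iA ->]; exists i; rewrite ?E.
Qed.

Lemma act_id (M : smonom) : smact id M = M.
Proof.
case: M => S A; rewrite /smact map_id seq_mset_id /=; congr (_, _).
by apply/fsetP => x; apply/imfsetP/idP => [[i iA ->]//|xS]; exists x.
Qed.

Lemma actK s s' : cancel s s' -> cancel (smact s) (smact s').
Proof.
move=> sK M; rewrite act_comp ?(can_inj sK) //; last exact: can_inj sK.
by rewrite (eq_act _ (sK : s' \o s =1 id)) act_id.
Qed.

Lemma factors_act s M P Q : injective s ->
  factors M (P, Q) -> factors (smact s M) (smact s P, smact s Q).
Proof.
move=> sI [/= dPQ E1 E2]; split=> /=.
- apply/fdisjointP => x /imfsetP[i iP ->]; apply/negP => /imfsetP[j jQ /sI ij].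
  by move/fdisjointP: dPQ => /(_ _ iP); rewrite ij jQ.
- apply/fsetP => x; rewrite -E1 in_fsetU; apply/orP/imfsetP.
    by case=> /imfsetP[i iP ->]; exists i; rewrite //= in_fsetU iP ?orbT.
  by case=> i; rewrite /= in_fsetU => /orP[] iP ->; [left|right]; apply/imfsetP; exists i.
- apply/msetP => x; rewrite msetE2 !mset_seqE -count_cat -map_cat.
  by apply/esym/seq.permP/perm_map; rewrite -E2; exact: perm_msetD.
Qed.

(* For i in P and j in Q, inverting the pair flips its contribution to
   [cross_inv]. *)
Lemma inversions_fsetU s (P Q : {fset nat}) : injective s -> [disjoint P & Q]%fset ->
  odd (inversions s (P `|` Q)%fset) (+) odd (cross_inv P Q) =
  odd (inversions s P) (+) odd (inversions s Q) (+)
  odd (cross_inv [fset s i | i in P]%fset [fset s i | i in Q]%fset).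
Proof.
move=> sI dPQ.
have -> : inversions s (P `|` Q)%fset = inversions s (P ++ Q).
  rewrite /inversions (perm_big _ (perm_fsetU dPQ)); apply: eq_bigr => i _.
  exact: (perm_big _ (perm_fsetU dPQ)).
have -> : inversions s (P ++ Q) = inversions s P + inversions s Q +
   \sum_(i <- P) \sum_(j <- Q) ((i < j) && (s j < s i) + (j < i) && (s i < s j)).
  rewrite {1}/inversions big_cat /=.
  under eq_bigr do rewrite big_cat.
  under [X in _ + X]eq_bigr do rewrite big_cat.
  rewrite !big_split /= -/(inversions s P) -/(inversions s Q).
  rewrite [X in _ + (X + _)](exchange_big_dep predT) //=.
  have -> : \sum_(i <- P) \sum_(j <- Q) ((i < j) && (s j < s i) + (j < i) && (s i < s j))
    = \sum_(i <- P) \sum_(j <- Q | i < j) (s j < s i) +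
      \sum_(j <- P) \sum_(i <- Q | i < j) (s j < s i).
    rewrite -big_split /=; apply: eq_bigr => i _; rewrite big_split /=; congr (_ + _).
      by rewrite [RHS]big_mkcond; apply: eq_bigr => j _; case: (i < j).
    by rewrite [RHS]big_mkcond; apply: eq_bigr => j _; case: (j < i).
  by rewrite [X in _ + X = _]addnC addnACA.
have -> : cross_inv [fset s i | i in P]%fset [fset s i | i in Q]%fset =
    \sum_(i <- P) \sum_(j <- Q) (s j < s i).
  rewrite /cross_inv (perm_big _ (perm_imfset P sI)) big_map; apply: eq_bigr => i _.
  by rewrite (perm_big _ (perm_imfset Q sI)) big_map.
(* For [i] different from [j] this holds pair by pair over the naturals; the doubled sum then
   disappears modulo 2. *)
have : \sum_(i <- P) \sum_(j <- Q) (s j < s i) +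
    2 * (\sum_(i <- P) \sum_(j <- Q) ((j < i) && (s i < s j))) = cross_inv P Q +
  \sum_(i <- P) \sum_(j <- Q) ((i < j) && (s j < s i) + (j < i) && (s i < s j)).
  rewrite /cross_inv big_distrr -!big_split /=; apply: eq_big_seq => i iP.
  rewrite big_distrr -!big_split /=; apply: eq_big_seq => j jQ.
  have ij : i <> j by move=> ij; move/fdisjointP: dPQ => /(_ _ iP); rewrite ij jQ.
  have sij : s i <> s j by move/sI.
  lia.
set x := \sum_(i <- P) _; set y := \sum_(i <- P) _; set z := \sum_(i <- P) _.
move/(congr1 odd); rewrite mul2n oddD odd_double addbF !oddD => ->.
by case: (odd (inversions s P)); case: (odd (inversions s Q)); case: (odd (cross_inv P Q)); case: (odd z).
Qed.

Lemma perm_invariantP f : perm_invariant f <->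
  forall s M, finitary_perm s -> f (smact s M) = ((-1) ^+ odd (inversions s M.1) * f M)%R.
Proof.
split=> h s M; first by move=> fs; apply: (h s) => //; apply/movesE => //; case: fs.
by move=> b M' fs /movesE[|-> ->]; [case: fs|exact: h].
Qed.

(** The permutation acts bijectively on the factorizations of a monomial, and [inversions_fsetU]
    matches the signs. *)
Lemma perm_invariant_smul f g :
  perm_invariant f -> perm_invariant g -> perm_invariant (smul f g).
Proof.
move=> /perm_invariantP hf /perm_invariantP hg; apply/perm_invariantP => s M fs.
have [[s' sK s'K] _] := fs; have sI := can_inj sK; have s'I := can_inj s'K.
rewrite /smul mulr_fsumr.
rewrite (@reindex_fsbig _ _ _ _ _ (fun PQ => (smact s PQ.1, smact s PQ.2)) (factors M)).
  apply: eq_fsbigr => -[P Q]; rewrite inE => -[/= dPQ E1 E2].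
  rewrite hf // hg // -[in RHS]E1 -[((-1) ^+ cross_inv P.1 Q.1)%R]signr_odd.
  rewrite [RHS]mulrA -signr_addb (inversions_fsetU sI dPQ) !signr_addb.
  by rewrite mulrACA [LHS]mulrA -[((-1) ^+ cross_inv _ _)%R]signr_odd; congr (_ * _)%R; rewrite mulrC.
split.
- by move=> [P Q] h; exact: factors_act.
- move=> [P Q] [P' Q'] _ _ E.
  have := congr1 (smact s' \o snd) E; have := congr1 (smact s' \o fst) E.
  by rewrite /= !(actK sK) => -> ->.
- move=> [P Q] h; exists (smact s' P, smact s' Q) => /=.
    by rewrite -[M](actK sK); exact: factors_act.
  by rewrite !(actK s'K).
Qed.

Lemma inversions_small s (S : seq nat) : size S <= 1 -> inversions s S = 0.
Proof.
case: S => [|x [|//]] _; rewrite /inversions ?big_nil // big_seq1 big_cons big_nil.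
by rewrite ltnn.
Qed.

(** With at most one theta variable there is nothing to reorder, so invariance of the support is
    enough. *)
Lemma perm_invariant_char (p : pred smonom) :
  (forall s M, injective s -> p (smact s M) = p M) ->
  (forall M, p M -> #|` M.1| <= 1) ->
  perm_invariant (fun M => ((p M : nat)%:Z)%R).
Proof.
move=> pact pM; apply/perm_invariantP => s M [/bij_inj sI _].
rewrite pact //; case: (boolP (p M)) => [/pM h|_]; last by rewrite mulr0.
by rewrite inversions_small // mul1r.
Qed.

Lemma size_act1 s M : injective s -> #|` (smact s M).1| = #|` M.1|.
Proof. by move=> sI; rewrite (perm_size (perm_imfset _ sI)) size_map. Qed.

Lemma perm_act2 s M : perm_eq (smact s M).2 (map s M.2).
Proof. exact: perm_eq_seq_mset. Qed.

Lemma size_act2 s M : size (smact s M).2 = size M.2.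
Proof. by rewrite (perm_size (perm_act2 s M)) size_map. Qed.

Lemma uniq_act2 s M : injective s -> uniq (smact s M).2 = uniq M.2.
Proof. by move=> sI; rewrite (perm_uniq (perm_act2 s M)) map_inj_uniq. Qed.

Lemma smonom_eq0 (M : smonom) : (M == (fset0, mset0)) = (#|` M.1| == 0) && (size M.2 == 0).
Proof.
case: M => S A; rewrite xpair_eqE cardfs_eq0 /=; congr (_ && _).
apply/eqP/eqP => [->|/size0nil A0]; first by rewrite enum_mset0.
by apply/msetP => x; rewrite -count_mem_mset A0 mset0E.
Qed.

Lemma perm_invariant_sone : perm_invariant sone.
Proof.
apply: perm_invariant_char => [s M sI|M]; rewrite !smonom_eq0.
  by rewrite size_act1 // size_act2.
by case/andP=> /eqP->.
Qed.

Lemma perm_invariant_esuper k : perm_invariant (esuper k).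
Proof.
apply: perm_invariant_char => [s M sI|M /and3P[/eqP-> _ _]//].
by rewrite -!cardfs_eq0 size_act1 // uniq_act2 // size_act2.
Qed.

Lemma perm_invariant_etilde k : perm_invariant (etilde k).
Proof.
apply: perm_invariant_char => [s M sI|M /and4P[/eqP-> _ _ _]//].
rewrite size_act1 // uniq_act2 // size_act2; congr [&& _, _, _ & _].
rewrite (perm_all _ (perm_act2 s M)) all_map; apply: eq_all => x /=.
congr (~~ _); apply/imfsetP/idP => [[y yM /sI->]//|xM].
by exists x.
Qed.

Lemma perm_invariant_eprod a s : perm_invariant (eprod a s).
Proof.
apply: perm_invariant_smul.
  elim: a => [|k a IH]; rewrite ?big_nil ?big_cons; first exact: perm_invariant_sone.
  by apply: perm_invariant_smul; [exact: perm_invariant_etilde|].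
elim: s => [|k s IH]; rewrite ?big_nil ?big_cons; first exact: perm_invariant_sone.
by apply: perm_invariant_smul; [exact: perm_invariant_esuper|].
Qed.

Definition swap (i j k : nat) := if k == i then j else if k == j then i else k.

Lemma swapK i j : involutive (swap i j).
Proof.
move=> k; rewrite /swap; case: (eqVneq k i) => [->|ki].
  by case: (eqVneq j i) => [->|_]; rewrite ?eqxx.
by case: (eqVneq k j) => [->|kj]; rewrite ?eqxx // (negbTE ki) (negbTE kj).
Qed.

Lemma finitary_swap i j : finitary_perm (swap i j).
Proof.
split; first by exists (swap i j); exact: swapK.
exists (i + j).+1 => k h; have ki : k == i = false by lia.
have kj : k == j = false by lia.
by rewrite /swap ki kj.
Qed.

(** The swap inverts the pair of [i] and [j], together with two pairs for each element of [S]
    strictly between them. *)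
Lemma odd_inversions_swap i j (S : seq nat) : i < j -> uniq S -> i \in S -> j \in S ->
  odd (inversions (swap i j) S).
Proof.
move=> ij uS iS jS.
have -> : inversions (swap i j) S = (\sum_(l <- S) (i < l < j)).*2.+1.
  have one x : x \in S -> \sum_(k <- S) (k == x) = 1.
    move=> xS; have := count_uniq_mem x uS; rewrite xS -sum1_count big_mkcond /= => <-.
    by apply: eq_bigr => k _; case: eqP.
  transitivity (\sum_(k <- S) \sum_(l <- S)
    ((k == i) * (i < l < j) + (l == j) * (i < k < j) + (k == i) * (l == j))).
    apply: eq_bigr => k _; rewrite big_mkcond; apply: eq_bigr => l _.
    rewrite /swap; do !case: ifP; lia.
  under eq_bigr do rewrite !big_split /= -!big_distrr -!big_distrl /= one //.
  rewrite !big_split /= -!big_distrl one //=.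
  by rewrite big1_eq // addn0 -addnn !mul1n addn1.
by rewrite /= odd_double.
Qed.

(** Swapping the two variables fixes the monomial and reverses its sign, so the coefficient equals
    its own opposite. *)
Lemma perm_invariant_eq_exponents f (M : smonom) i j : perm_invariant f ->
  i < j -> i \in M.1 -> j \in M.1 -> M.2 i = M.2 j -> f M = 0%R.
Proof.
move=> /perm_invariantP hf ij iM jM E.
have := hf _ M (finitary_swap i j); rewrite odd_inversions_swap ?fset_uniq //.
have sI := can_inj (swapK i j).
have -> : smact (swap i j) M = M.
  have swM k : (swap i j k \in M.1) = (k \in M.1).
    by rewrite /swap; do 2 (case: eqP => [->|_]; rewrite ?iM ?jM //).
  case: M iM jM E swM => S A /= iM jM E swM; congr (_, _).
    apply/fsetP => k; apply/imfsetP/idP => [[l lS ->]|kS]; first by rewrite swM.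
    by exists (swap i j k); rewrite ?swapK //= swM.
  apply/msetP => k; rewrite -[k](swapK i j) (act_mset (S, A)) //= swapK /swap.
  by do 2 (case: eqP => [->|_] //).
rewrite expr1 mulN1r => h; apply/eqP; lia.
Qed.

(** * Monomial superfunctions *)

Lemma count_mem_flatten_nseq (F : nat -> nat) t x : uniq t ->
  count_mem x (flatten [seq nseq (F j) j | j <- t]) = if x \in t then F x else 0.
Proof.
elim: t => //= j t IH /andP[jt ut]; rewrite count_cat count_nseq IH // in_cons /=.
by case: (eqVneq j x) jt => [->|jx] /negbTE jt; rewrite ?jt ?mul1n ?addn0.
Qed.

Lemma size_mset_sum (A : {mset nat}%mset) t : uniq t -> {subset A <= t} ->
  size A = sumn [seq A j | j <- t].
Proof.
move=> ut At.
have p : perm_eq A (flatten [seq nseq (A j) j | j <- t]).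
  apply/allP => x _ /=; rewrite count_mem_flatten_nseq // count_mem_mset.
  by case: ifPn => // xt; apply/eqP/mset_eq0P; apply: contra xt; exact: At.
rewrite (perm_size p) size_flatten /shape -map_comp; congr sumn.
by apply: eq_map => j /=; rewrite size_nseq.
Qed.

Lemma finitary_perm_ext (t : seq nat) : uniq t ->
  exists2 s, finitary_perm s & forall i, i < size t -> s i = nth 0 t i.
Proof.
(* Each entry of [t] is at most [sumn t], so [t] can be completed by the missing indices to a
   permutation of the indices below [N]. *)
move=> ut; pose N := (sumn t).+1.
pose u := t ++ [seq i <- iota 0 N | i \notin t].
have pu : perm_eq u (iota 0 N).
  apply: uniq_perm; rewrite ?iota_uniq //.
    rewrite cat_uniq ut filter_uniq ?iota_uniq // andbT.
    by apply/hasPn => x; rewrite mem_filter => /andP[].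
  move=> x; rewrite mem_cat mem_filter mem_iota; case: (boolP (x \in t)) => //= xt.
  by rewrite add0n /N ltnS; apply/esym/mem_leq_sumn.
have uu : uniq u by rewrite (perm_uniq pu) iota_uniq.
have su : size u = N by rewrite (perm_size pu) size_iota.
have mu x : (x \in u) = (x < N) by rewrite (perm_mem pu) mem_iota.
(* The default value [i] makes the map the identity beyond [N]. *)
exists (fun i => nth i u i); last first.
  by move=> i it; rewrite nth_cat it; exact: set_nth_default.
split; last by exists N => i h; rewrite nth_default // su.
exists (fun x => if x < N then index x u else x) => x.
  case: (ltnP x N) => xN; last by rewrite nth_default ?su // ltnNge xN.
  by rewrite -mu mem_nth ?su // index_uniq ?su.
case: (ltnP x N) => xN; last by rewrite nth_default ?su.
by rewrite nth_index // mu.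
Qed.

Lemma sp_monom_exponent n m (L : superpart n m) i :
  (sp_monom L).2 i = nth 0 (L.1 ++ L.2) i.
Proof.
rewrite /sp_monom /= mset_seqE count_mem_flatten_nseq ?iota_uniq // mem_iota /= add0n.
by case: ltnP => // h; rewrite nth_default.
Qed.

Lemma sp_monom_theta n m (L : superpart n m) i : (i \in (sp_monom L).1) = (i < m).
Proof. by rewrite inE mem_iota. Qed.

Lemma gtn_trans : transitive gtn.
Proof. by move=> y x z /= yx zy; exact: ltn_trans zy yx. Qed.

Lemma geq_anti : antisymmetric geq.
Proof. by move=> x y /= h; apply/eqP; rewrite eqn_leq andbC. Qed.

Lemma gtn_sorted_geq (s : seq nat) : sorted gtn s -> sorted geq s.
Proof. by apply: sub_sorted => x y; exact: ltnW. Qed.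

Lemma sp_sorted1 n m (L : superpart n m) : sorted gtn L.1.
Proof. by case/and5P: (superpartP L). Qed.

Lemma sp_sorted2 n m (L : superpart n m) : sorted geq L.2.
Proof. by case/and5P: (superpartP L). Qed.

Lemma sp_notin0 n m (L : superpart n m) : 0 \notin L.2.
Proof. by case/and5P: (superpartP L). Qed.

(** Two invariants of an orbit: the first recovers [L.1], after which the second recovers [L.2]. *)
Lemma orbit_exponents n m (L : superpart n m) s M : bijective s ->
  M = smact s (sp_monom L) ->
  perm_eq [seq M.2 i | i <- M.1] L.1 /\
  perm_eq [seq M.2 i | i <- undup M.2] [seq k <- L.1 ++ L.2 | k != 0].
Proof.
move=> bs ->; have sI := bij_inj bs; set M0 := sp_monom L; split.
  have /permPl -> := perm_map (smact s M0).2 (perm_imfset M0.1 sI).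
  rewrite -map_comp (eq_map (act_mset M0 sI)).
  have /permPl -> := perm_map M0.2 (perm_fset_seq (iota_uniq 0 m)).
  rewrite (eq_map (sp_monom_exponent L)).
  suff -> : [seq nth 0 (L.1 ++ L.2) i | i <- iota 0 m] = L.1 by [].
  apply: (@eq_from_nth _ 0); rewrite size_map size_iota ?sp_size1 // => i im.
  by rewrite (nth_map 0) ?size_iota // nth_iota // nth_cat sp_size1 im.
have p : perm_eq (undup (smact s M0).2)
    (map s [seq i <- iota 0 (size (L.1 ++ L.2)) | nth 0 (L.1 ++ L.2) i != 0]).
  apply: uniq_perm; rewrite ?undup_uniq ?map_inj_uniq ?filter_uniq ?iota_uniq // => x.
  have [s' sK s'K] := bs; rewrite mem_undup -[x]s'K mem_map // mem_filter mem_iota.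
  rewrite in_mset act_mset // sp_monom_exponent lt0n add0n.
  by case: ltnP => h; rewrite ?andbT // nth_default.
have /permPl -> := perm_map (smact s M0).2 p.
rewrite -map_comp (eq_map (act_mset M0 sI)) (eq_map (sp_monom_exponent L)).
rewrite -(filter_map (nth 0 (L.1 ++ L.2)) (fun k => k != 0)).
by rewrite -/(mkseq _ _) mkseq_nth.
Qed.

(** The parts of [L.1] are distinct, so exponents identify the theta variables and two permutations
    with the same image agree on the first [m] indices. Hence no monomial occurs with both signs. *)
Lemma orbit_unique n m (L L' : superpart n m) s s' b b' M :
  finitary_perm s -> finitary_perm s' ->
  moves s (sp_monom L) b M -> moves s' (sp_monom L') b' M -> L = L' /\ b = b'.
Proof.
move=> [bs _] [bs' _] /(movesE _ _ _ bs)[ML ->] /(movesE _ _ _ bs')[ML' ->].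
have [p1 p2] := orbit_exponents bs ML; have [q1 q2] := orbit_exponents bs' ML'.
have E1 : L.1 = L'.1.
  apply: (sorted_eq geq_trans geq_anti); rewrite ?gtn_sorted_geq ?sp_sorted1 //.
  by rewrite -(permPl p1).
have nz (K : superpart n m) : [seq k <- K.2 | k != 0] = K.2.
  by apply/all_filterP/allP => k kK; apply: contraNneq (sp_notin0 K) => <-.
have E2 : L.2 = L'.2.
  apply: (sorted_eq geq_trans geq_anti); rewrite ?sp_sorted2 //.
  move: p2; rewrite (permPl q2) !filter_cat !nz E1 perm_cat2l.
  by rewrite perm_sym.
have EL : L = L'.
  by apply: val_inj; case: L L' E1 E2 {ML ML' p1 p2 q1 q2 nz} => -[a c] ? [[a' c'] ?] /= -> ->.
split=> //; rewrite -EL in ML' *.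
have ss' p : p < m -> s p = s' p.
  move=> pm; have spM : s p \in M.1.
    by rewrite ML; apply/imfsetP; exists p; rewrite // sp_monom_theta.
  have := spM; rewrite {1}ML' => /imfsetP[q]; rewrite sp_monom_theta => qm E.
  have := act_mset (sp_monom L) (bij_inj bs) p; rewrite -ML E ML' act_mset ?bij_inj //; last exact: bij_inj.
  rewrite !sp_monom_exponent !nth_cat sp_size1 pm qm => /eqP.
  by rewrite nth_uniq ?sp_size1 ?sp_uniq1 // => /eqP->.
congr odd; rewrite /inversions; apply: eq_big_seq => i; rewrite sp_monom_theta => im.
rewrite big_seq_cond [RHS]big_seq_cond; apply: eq_bigr => j /andP[].
by rewrite sp_monom_theta => jm _; rewrite !ss'.
Qed.

Lemma sorted_geq_uniq (s : seq nat) : sorted geq s -> uniq s -> sorted gtn s.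
Proof.
elim: s => //= x s IH; rewrite (path_sortedE geq_trans) (path_sortedE gtn_trans).
move=> /andP[/allP xs ss] /andP[xNs us]; rewrite IH // andbT.
apply/allP => y ys /=; rewrite ltn_neqAle (xs _ ys : y <= x) andbT.
by apply: contraNneq xNs => <-.
Qed.

(** List the theta variables by decreasing exponent, then the remaining variables in the same way.
    Injectivity of the exponents on the theta variables makes the antisymmetric part strictly
    decreasing. *)
Lemma orbit_exists n m (M : smonom) : size M.2 = n -> #|` M.1| = m ->
  {in M.1 &, injective M.2} ->
  exists (L : superpart n m) s b, finitary_perm s /\ moves s (sp_monom L) b M.
Proof.
case: M => S A /= sA sS injA.
pose ord i j := A j <= A i.
have ord_tot : total ord by move=> i j; exact: leq_total.
pose t1 := sort ord S; pose t2 := sort ord [seq i <- undup A | i \notin S].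
have mt1 x : (x \in t1) = (x \in S) by rewrite mem_sort.
have mt2 x : (x \in t2) = (x \notin S) && (x \in A).
  by rewrite mem_sort mem_filter mem_undup.
have ut : uniq (t1 ++ t2).
  rewrite cat_uniq !sort_uniq fset_uniq filter_uniq ?undup_uniq // andbT.
  by apply/hasPn => x; rewrite mt2 /= mt1 => /andP[].
have srt (r : seq nat) : sorted geq [seq A i | i <- sort ord r].
  by rewrite sorted_map; exact: sort_sorted.
have Lp : is_superpart n m (map A t1, map A t2).
  apply/and5P; split=> /=.
  - by rewrite size_map size_sort sS.
  - apply: sorted_geq_uniq; first exact: srt.
    rewrite map_inj_in_uniq ?sort_uniq ?fset_uniq // => x y.
    by rewrite !mt1; exact: injA.
  - exact: srt.
  - apply/negP => /mapP[x]; rewrite mt2 in_mset => /andP[_ h] E.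
    by rewrite -E in h.
  - rewrite -sumn_cat -map_cat -sA (@size_mset_sum A (t1 ++ t2)) // => x xA.
    by rewrite mem_cat mt1 mt2 xA andbT orbN.
have [s fs st] := finitary_perm_ext ut; have [bs _] := fs.
pose L := Superpart Lp; exists L, s, (odd (inversions s (sp_monom L).1)).
split=> //; apply/movesE => //; split=> //.
have st1 : size t1 = m by rewrite size_sort sS.
have [s' sK s'K] := bs; have sI := can_inj sK.
congr (_, _).
  apply/fsetP => x; apply/idP/imfsetP => /=.
    rewrite -mt1 => xt; have xm : index x t1 < m by rewrite -st1 index_mem.
    exists (index x t1); first by rewrite inE mem_iota.
    rewrite st; last by rewrite size_cat st1; exact: leq_trans xm (leq_addr _ _).
    by rewrite nth_cat st1 xm nth_index.
  move=> [i]; rewrite !inE mem_iota /= add0n => im ->.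
  rewrite st; last by rewrite size_cat st1; exact: leq_trans im (leq_addr _ _).
  by rewrite nth_cat st1 im -mt1 mem_nth // st1.
apply/msetP => x; rewrite -[x]s'K; set i := s' x.
rewrite (act_mset (sp_monom L) sI) sp_monom_exponent /= -map_cat.
case: (ltnP i (size (t1 ++ t2))) => h; first by rewrite (nth_map 0) // st.
rewrite nth_default ?size_map //; apply/mset_eq0P/negP => sA'.
have : s i \in t1 ++ t2 by rewrite mem_cat mt1 mt2 sA' andbT orbN.
move=> /(nthP 0)[j jt]; rewrite -st // => /sI ji.
by move: h; rewrite -ji leqNgt jt.
Qed.

Lemma msuperE n m (L K : superpart n m) s b M : finitary_perm s ->
  moves s (sp_monom L) b M ->
  msuper K M = (if K == L then (-1) ^+ b else 0)%R.
Proof.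
move=> fs mv; have orb c : Defs.in_orbit K c M <-> K = L /\ c = b.
  split=> [[s' fs' mv']|[-> ->]]; first exact: orbit_unique fs' fs mv' mv.
  by exists s.
rewrite /msuper; case: eqP => [KL|KL]; last first.
  by do 2 (rewrite asboolF; last by move/orb => []); rewrite subrr.
case: b mv orb => mv orb.
  by rewrite asboolF ?asboolT; [rewrite sub0r|apply/orb|move/orb => []].
by rewrite asboolT ?asboolF; [rewrite subr0|move/orb => []|apply/orb].
Qed.

Lemma finitary_id : finitary_perm id.
Proof. by split; [exists id|exists 0]. Qed.

Lemma moves_id M : moves id M false M.
Proof.
have bid : bijective (@id nat) by exists id.
apply/movesE => //; rewrite act_id; split=> //.
rewrite /inversions big1 // => i _; rewrite big1 // => j ij.
by rewrite ltnNge (ltnW ij).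
Qed.

Lemma msuper_sp_monom n m (K L : superpart n m) :
  msuper K (sp_monom L) = ((K == L : nat)%:Z)%R.
Proof.
by rewrite (msuperE K finitary_id (moves_id (sp_monom L))); case: eqP.
Qed.

Lemma mulrz_fctE (f : superseries) (z : int) M : ((f *~ z) M = f M * z)%R.
Proof.
by rewrite -mulrzz; case: z => k; rewrite /intmul ?opprfctE natmulfctE.
Qed.

(** An invariant series is determined by one coefficient per orbit. A monomial of the right degrees
    outside all orbits has two theta variables with equal exponents, where the coefficient
    vanishes. *)
Lemma symsuper_msuper n m f : symsuper n m f ->
  (f = \sum_(K : superpart n m) msuper K *~ f (sp_monom K))%R.
Proof.
move=> [hom inv]; apply: funext => M; rewrite fct_sumE.
under eq_bigr do rewrite mulrz_fctE.
have [[L [s [b [fs mv]]]]|none] := pselect (exists (L : superpart n m) s b,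
    finitary_perm s /\ moves s (sp_monom L) b M).
  rewrite (bigD1 L) //= big1 ?addr0 => [|K /negbTE KL].
    by rewrite (msuperE L fs mv) eqxx; exact: inv fs mv.
  by rewrite (msuperE K fs mv) KL mul0r.
rewrite big1 => [|K _]; last first.
  have orb b : ~ Defs.in_orbit K b M.
    by case=> s fs mv; apply: none; exists K, s, b.
  rewrite /msuper !asboolF //.
  by rewrite subrr mul0r.
apply: contra_notP none => /eqP nz; have [sM cM] := hom _ nz.
apply: orbit_exists => // i j iM jM E; apply/eqP; apply: contraNT nz => ij.
have [lt|lt|e] := ltngtP i j.
- by rewrite (perm_invariant_eq_exponents inv lt iM jM E).
- by rewrite (perm_invariant_eq_exponents inv lt jM iM).
- by move: ij; rewrite e eqxx.
Qed.

(** * Bruhat order on minimal sorting permutations *)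

Section BruhatOrder.
Variable N : nat.
Implicit Types (u v w : 'S_N) (l : N.-tuple nat).

(** Exchanging two neighbours reverses the order of no other pair. *)
Lemma adjacent_tperm_lt (a b p q : 'I_N) : b = a.+1 :> nat -> p < q ->
  (p, q) != (a, b) -> tperm a b p < tperm a b q.
Proof.
move=> ab pq; rewrite xpair_eqE -!val_eqE /= => ne.
by rewrite !permE /= -!val_eqE /=; do !case: ifP; lia.
Qed.

(** Relabelling positions by the transposition injects the inversions of [u] into those of the
    product, and [(a, b)] is an additional one. *)
Lemma perm_length_tperm u (a b : 'I_N) : b = a.+1 :> nat -> u a < u b ->
  perm_length u < perm_length (tperm a b * u)%g.
Proof.
move=> ab uab; rewrite /perm_length; set X := [set p | _]; set Y := [set p | _].
pose h (p : 'I_N * 'I_N) := (tperm a b p.1, tperm a b p.2).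
have hI : injective h by move=> [p q] [p' q'] [/perm_inj-> /perm_inj->].
have abY : (a, b) \in Y by rewrite inE /= !permM tpermL tpermR uab ab ltnSn.
rewrite -(card_imset _ hI) (cardsD1 (a, b) Y) abY add1n ltnS; apply: subset_leq_card.
apply/fintype.subsetP => z /imsetP[[p q]]; rewrite inE /= => /andP[pq upq] ->.
have ne : (p, q) != (a, b).
  by apply: contraTneq upq => -[-> ->]; rewrite -leqNgt ltnW.
have lt := adjacent_tperm_lt ab pq ne.
rewrite in_setD1 inE /= !permM !tpermK lt upq !andbT xpair_eqE; apply/negP.
case/andP=> /eqP pa /eqP qb; move: pq.
by rewrite -[p](tpermK a b) -[q](tpermK a b) pa qb tpermL tpermR ab ltnNge leqnSn.
Qed.

Lemma perm_length_bound w : perm_length w <= N * N.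
Proof. by apply: leq_trans (max_card _) _; rewrite card_prod card_ord. Qed.

Lemma sorts_to_ex l : exists w, sorts_to w l.
Proof.
have /tuple_permP[w E] : perm_eq (decr l) l by rewrite perm_sort.
exists w; apply/forallP => i; apply/eqP.
by rewrite (tnth_nth 0 (decr l)) /= E -(tnth_nth 0 [tuple _ | _ < N]) tnth_mktuple.
Qed.

Lemma min_permP l : sorts_to (min_perm l) l /\
  forall v, sorts_to v l -> perm_length (min_perm l) <= perm_length v.
Proof.
rewrite /min_perm; case: pickP => [w /andP[sw /forallP h]|none] /=.
  by split=> // v sv; have := h v; rewrite sv.
have [w sw] := sorts_to_ex l.
case: (@arg_minnP _ w (fun w => sorts_to w l) (@perm_length N) sw) => v sv h.
have := none v; rewrite sv /=; case/negP; apply/forallP => v'; apply/implyP; exact: h.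
Qed.

Lemma min_permE l i : tnth l (min_perm l i) = tnth (decr l) i.
Proof. by have [/forallP/(_ i)/eqP] := min_permP l. Qed.

Lemma decr_homo l (i j : 'I_N) : i <= j -> tnth (decr l) j <= tnth (decr l) i.
Proof.
move=> ij; rewrite !(tnth_nth 0) /=.
have srt : sorted geq (sort geq l).
  by apply: sort_sorted => x y; exact: leq_total.
by apply: (sorted_leq_nth geq_trans leqnn 0 srt) => //; rewrite inE size_sort size_tuple.
Qed.

(* Minimal length makes the sorting stable. *)
Lemma min_perm_stable l (i j : 'I_N) : i < j ->
  tnth (decr l) i = tnth (decr l) j -> min_perm l i < min_perm l j.
Proof.
set w := min_perm l.
have adj (a b : 'I_N) : b = a.+1 :> nat -> tnth (decr l) a = tnth (decr l) b -> w a < w b.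
  move=> ab E; rewrite ltnNge leq_eqVlt negb_or; apply/andP; split.
    by apply/eqP => /val_inj/perm_inj ba; move: ab; rewrite ba => /eqP; rewrite ltn_eqF.
  apply/negP => lt; pose v := (tperm a b * w)%g.
  have sv : sorts_to v l.
    apply/forallP => k; rewrite permM min_permE; apply/eqP.
    by case: tpermP => [->|->|].
  have [_ /(_ _ sv)] := min_permP l; rewrite leqNgt => /negP; apply.
  have -> : min_perm l = (tperm a b * v)%g by rewrite /v mulgA tperm2 mul1g.
  by apply: perm_length_tperm => //; rewrite !permM tpermL tpermR.
move=> ij; have [d jE] : exists d, j = i + d.+1 :> nat by exists (j - i).-1; lia.
elim: d j jE {ij} => [|d IH] j jE E; first by apply: adj => //; rewrite jE addn1.
have kN : i + d.+1 < N by have := ltn_ord j; rewrite jE; lia.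
pose k := Ordinal kN.
have Ek : tnth (decr l) i = tnth (decr l) k.
  apply/eqP; rewrite eqn_leq {1}E !decr_homo //=; lia.
apply: leq_trans (IH k (erefl _) Ek) (ltnW _).
by apply: adj; rewrite -?Ek //= jE; lia.
Qed.

Lemma min_perm_inv_lt l (p q : 'I_N) : p < q -> tnth l q <= tnth l p ->
  (min_perm l)^-1%g p < (min_perm l)^-1%g q.
Proof.
move=> pq; set w := min_perm l; set i := w^-1%g p; set j := w^-1%g q.
have -> : p = w i by rewrite permKV.
have -> : q = w j by rewrite permKV.
rewrite !min_permE => le; rewrite ltnNge; apply/negP => ji.
have E : tnth (decr l) j = tnth (decr l) i.
  by apply/eqP; rewrite eqn_leq le decr_homo.
move: ji; rewrite leq_eqVlt => /orP[/eqP/val_inj ji|ji].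
  by move: pq; rewrite -[p](permKV w) -[q](permKV w) -/i -/j ji ltnn.
have := min_perm_stable ji E; rewrite -/w /i /j !permKV => qp.
by move: pq; rewrite ltnNge ltnW.
Qed.

Lemma bruhat_le_length u v : bruhat_le u v -> u = v \/ perm_length u < perm_length v.
Proof.
case/connectP=> s; elim: s u => [|w s IH] u /=; first by move=> _ ->; left.
case/andP=> /andP[_ uw] /IH h /h [<-|wv]; right=> //; exact: ltn_trans uw wv.
Qed.

(** An increasing permutation moves no point down; its inverse is increasing as well, so no point
    moves up. *)
Lemma increasing_perm_id w : (forall p q : 'I_N, p < q -> w p < w q) -> w = 1%g.
Proof.
have le (v : 'S_N) : (forall p q : 'I_N, p < q -> v p < v q) -> forall p : 'I_N, p <= v p.
  move=> h [p pN] /=; elim: p pN => // p IH pN.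
  have pN' := ltnW pN; apply: leq_ltn_trans (IH pN') _; exact: h.
move=> h; apply/permP => p; rewrite perm1; apply/val_inj/eqP => /=.
rewrite eqn_leq le // andbT; have := le w^-1%g _ (w p); rewrite permK; apply=> r q rq.
rewrite ltnNge leq_eqVlt negb_or; apply/andP; split.
  by apply/eqP => /val_inj/perm_inj qr; move: rq; rewrite qr ltnn.
by apply/negP => /h; rewrite !permKV => qr; move: rq; rewrite ltnNge ltnW.
Qed.

(* Inverses of Grassmannian permutations with descent at [m]; they are
   determined by the preimage of the first [m] positions. *)
Definition inv_grassmannian m w := forall p q : 'I_N, p < q -> (q < m) || (m <= p) ->
  w^-1%g p < w^-1%g q.

Lemma inv_grassmannian_inj m u v : inv_grassmannian m u -> inv_grassmannian m v ->
  (forall p : 'I_N, p < m -> u^-1%g p = v^-1%g p) -> u = v.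
Proof.
move=> gu gv E; suff : (u^-1 * v = 1)%g.
  by move/(congr1 (mulg u)); rewrite mulKVg mulg1.
have fix_ (p : 'I_N) : p < m -> (u^-1 * v)%g p = p by move=> pm; rewrite permM E ?permKV.
have big_ (p : 'I_N) : m <= p -> m <= (u^-1 * v)%g p.
  move=> mp; rewrite leqNgt; apply/negP => lt; have /perm_inj e := fix_ _ lt.
  by move: lt; rewrite e ltnNge mp.
apply: increasing_perm_id => p q pq; have [qm|mq] := ltnP q m.
  by rewrite !fix_ // (ltn_trans pq qm).
have [pm|mp] := ltnP p m; first by rewrite fix_ // (leq_trans pm) // big_.
rewrite ltnNge leq_eqVlt negb_or; apply/andP; split.
  by apply/eqP => /val_inj/perm_inj qp; move: pq; rewrite qp ltnn.
apply/negP => lt; have := gv _ _ lt; rewrite big_ // orbT !permM !permK => /(_ isT).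
by rewrite ltnNge ltnW // gu ?mp ?orbT.
Qed.

(** Climb from [u] to [v]. At the largest [p < m] where the preimages differ, exchanging the
    position of [p] with the next one lengthens [u], keeps the Grassmannian shape and keeps the
    inequalities. Lengths are bounded by [N * N], so the process stops. *)
Lemma bruhat_inv_grassmannian m u v : inv_grassmannian m u -> inv_grassmannian m v ->
  (forall p : 'I_N, p < m -> u^-1%g p <= v^-1%g p) -> bruhat_le u v.
Proof.
have [d] := ubnP (N * N - perm_length u); elim: d u => // d IH u ud gu gv le.
have [/existsP[p0 /andP[p0m p0lt]]|none] :=
    boolP [exists p : 'I_N, (p < m) && (u^-1%g p < v^-1%g p)]; last first.
  suff -> : u = v by exact: connect0.
  apply: inv_grassmannian_inj gu gv _ => p pm; apply/val_inj/eqP; rewrite eqn_leq le //=.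
  move/existsPn: none => /(_ p); rewrite pm /= -leqNgt; exact.
have [p] := @arg_maxnP _ p0 (fun p : 'I_N => (p < m) && (u^-1%g p < v^-1%g p))
  (fun p => p) (introT andP (conj p0m p0lt)).
case/andP=> pm plt pmax.
pose a := u^-1%g p; have aN : a.+1 < N by exact: leq_ltn_trans plt (ltn_ord _).
pose b := Ordinal aN; pose q := u b.
have ua : u a = p by rewrite permKV.
have ub : u^-1%g q = b by rewrite permK.
(* Otherwise [p < q < m], and maximality of [p] puts [q] in [v] no later than position [a.+1], hence
   no later than [p], against the increase of the inverse of [v] on the first block. *)
have mq : m <= q.
  rewrite leqNgt; apply/negP => qm.
  have pq : p < q.
    rewrite ltnNge leq_eqVlt negb_or; apply/andP; split.
      apply/eqP => /val_inj qp; have := congr1 (u^-1%g) qp; rewrite ub -/a.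
      by move/(congr1 val)/eqP; rewrite /= gtn_eqF.
    apply/negP => qp; have := gu _ _ qp; rewrite pm ub -/a => /(_ isT) /=.
    by rewrite ltnNge leqnSn.
  have := gv _ _ pq; rewrite qm => /(_ isT); apply/negP; rewrite -leqNgt.
  apply: leq_trans plt; rewrite -/a -[a.+1]/(val b) -ub leqNgt; apply/negP => lt.
  have qp : q <= p by apply: pmax; rewrite qm lt.
  by move: qp; rewrite leqNgt pq.
pose u' := (tperm a b * u)%g.
have u'V x : u'^-1%g x = tperm a b (u^-1%g x) by rewrite invMg tpermV permM.
have lt : perm_length u < perm_length u'.
  by apply: perm_length_tperm => //; rewrite ua (leq_trans pm).
have gu' : inv_grassmannian m u'.
  move=> r s rs blk; rewrite !u'V; apply: adjacent_tperm_lt => //; first exact: gu.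
  rewrite xpair_eqE; apply: contraTN blk => /andP[/eqP ra /eqP sb].
  have -> : r = p by rewrite -ua -ra permKV.
  have -> : s = q by rewrite /q -sb permKV.
  by rewrite negb_or -leqNgt mq -ltnNge pm.
apply: (connect_trans (y := u')).
  apply: connect1; rewrite /= lt andbT; apply/existsP; exists p; apply/existsP; exists q.
  (* Exchanging the positions [a] and [b] is the same as exchanging the values [p] and [q], the form
     used in [bruhat_le]. *)
  apply/eqP/permP => x; rewrite !permM -ua /q; exact: inj_tperm perm_inj.
apply: IH => //; first by have := perm_length_bound u'; lia.
move=> r rm; rewrite u'V; case: tpermP => [ra|rb|_ _]; last exact: le.
  have -> : r = p by rewrite -ua -ra permKV.
  exact: plt.
have rq : r = q by rewrite /q -rb permKV.
by move: rm; rewrite rq ltnNge mq.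
Qed.

End BruhatOrder.

(** * Sorting the variables of a superpartition *)

Lemma eq_from_ltn (x y : nat) : (forall k, (k < x) = (k < y)) -> x = y.
Proof.
by move=> h; have hx := h x; have hy := h y; rewrite !ltnn in hx hy; lia.
Qed.

Definition ext_perm N (w : 'S_N) (i : nat) : nat := oapp (fun j => val (w j)) i (insub i).

Lemma ext_permE N (w : 'S_N) (i : 'I_N) : ext_perm w i = w i.
Proof. by rewrite /ext_perm valK. Qed.

Lemma ext_perm_out N (w : 'S_N) i : N <= i -> ext_perm w i = i.
Proof. by move=> h; rewrite /ext_perm insubF // ltnNge h. Qed.

Lemma ext_permK N (w : 'S_N) : cancel (ext_perm w) (ext_perm w^-1).
Proof.
move=> i; have [iN|Ni] := ltnP i N; last by rewrite !ext_perm_out.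
by rewrite -[i]/(val (Ordinal iN)) !ext_permE permK.
Qed.

Lemma finitary_ext_perm N (w : 'S_N) : finitary_perm (ext_perm w).
Proof.
split; last by exists N => i; exact: ext_perm_out.
exists (ext_perm w^-1); first exact: ext_permK.
by move=> i; rewrite -{1}[w]invgK ext_permK.
Qed.

Section SortingPermutation.
Variables (n m : nat) (L : superpart n m).
Let l := sp_comp L.
Let w := min_perm l.
Let s := ext_perm w^-1.

Lemma sp_compE (p : 'I_(m + n)) : tnth l p = nth 0 (L.1 ++ L.2) p.
Proof. by rewrite tnth_mktuple. Qed.

Lemma val_sp_comp : l = L.1 ++ L.2 ++ nseq (m + n - size (L.1 ++ L.2)) 0 :> seq nat.
Proof.
have le := size_sp_comp L.
apply: (@eq_from_nth _ 0) => [|i].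
  by rewrite size_tuple catA size_cat size_nseq subnKC.
rewrite size_tuple => iN; rewrite -[i]/(val (Ordinal iN)) -tnth_nth sp_compE /=.
by rewrite catA [RHS]nth_cat nth_nseq if_same; case: ltnP => // h; rewrite nth_default.
Qed.

Lemma count_sp_comp k : count (ltn k) l = count (ltn k) (sp_entries L).
Proof. by rewrite val_sp_comp catA count_cat count_nseq mul0n addn0. Qed.

Lemma sumn_decr_sp_comp : sumn (decr l) = n.
Proof.
rewrite (perm_sumn (_ : perm_eq _ l)) ?perm_sort // val_sp_comp !sumn_cat.
by rewrite sumn_nseq mul0n addn0 sp_sumn.
Qed.

Lemma nth_decr_sp_comp j : nth 0 (decr l) j = (sp_row L j).1.
Proof.
apply: eq_from_ltn => k; rewrite /sp_row nth_fst.
rewrite !nth_sorted_count ?sp_rows_geq //; last first.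
  by apply: sort_sorted => x y; exact: leq_total.
rewrite (seq.permP (perm_sp_rows L)) (seq.permP (_ : perm_eq (decr l) l)) ?perm_sort //.
by rewrite count_sp_comp.
Qed.

Lemma nth_sp1 p : p < m -> nth 0 (L.1 ++ L.2) p = nth 0 L.1 p.
Proof. by move=> pm; rewrite nth_cat sp_size1 pm. Qed.

Lemma nth_sp1_lt p q : p < q -> q < m -> nth 0 L.1 q < nth 0 L.1 p.
Proof.
move=> pq qm; apply: (sorted_ltn_nth gtn_trans 0 (sp_sorted1 L)) => //.
  by rewrite inE sp_size1 (ltn_trans pq).
by rewrite inE sp_size1.
Qed.

(** Each of the two blocks of the composition is already decreasing, so stable sorting preserves the
    order inside it. *)
Lemma min_perm_inv_grassmannian : inv_grassmannian m w.
Proof.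
move=> p q pq blk; apply: min_perm_inv_lt => //; rewrite !sp_compE.
case/orP: blk => [qm|mp].
  by rewrite !nth_sp1 ?(ltn_trans pq qm) //; apply: ltnW; exact: nth_sp1_lt.
rewrite !nth_cat sp_size1 !ltnNge mp (leq_trans mp (ltnW pq)) /=.
have [h|h] := ltnP (q - m) (size L.2); last by rewrite [X in X <= _]nth_default.
apply: (sorted_leq_nth geq_trans leqnn 0 (sp_sorted2 L)); rewrite ?inE //; lia.
Qed.

(** A part of [L.1] comes before all equal entries, which lie in [L.2], so stable sorting puts only
    strictly larger entries ahead of it. *)
Lemma min_perm_inv_circled (p : 'I_(m + n)) : p < m ->
  w^-1%g p = count (ltn (nth 0 L.1 p)) (sp_entries L) :> nat.
Proof.
move=> pm; set c := count _ _.
have lp : tnth l p = nth 0 L.1 p by rewrite sp_compE nth_sp1.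
have h (j : 'I_(m + n)) : (j < w^-1%g p) = (j < c).
  rewrite /c -count_sp_comp -(seq.permP (_ : perm_eq (decr l) l)) ?perm_sort //.
  rewrite -nth_sorted_count -?tnth_nth; last first.
    by apply: sort_sorted => x y; exact: leq_total.
  have E : tnth (decr l) (w^-1%g p) = nth 0 L.1 p by rewrite -min_permE permKV.
  apply/idP/idP => [lt|]; last first.
    by rewrite -E ltnNge; apply: contraR; rewrite -leqNgt; exact: decr_homo.
  rewrite ltn_neqAle -{2}E decr_homo ?(ltnW lt) // andbT; apply/eqP => e.
  have := min_perm_stable lt (etrans (esym e) (esym E)).
  rewrite -/w permKV => wjp; have := nth_sp1_lt wjp pm.
  by rewrite -[X in _ < X]nth_sp1 ?(ltn_trans wjp) // -sp_compE min_permE -e ltnn.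
have cN : c <= m + n.
  by rewrite /c -count_sp_comp (leq_trans (count_size _ _)) // size_tuple.
apply/eqP; rewrite eqn_leq; apply/andP; split; rewrite leqNgt; apply/negP => lt.
  have := h (Ordinal (leq_trans lt (ltnW (ltn_ord _)))).
  by rewrite /= lt ltnn.
by have := h (w^-1%g p); rewrite ltnn lt.
Qed.

Lemma sort_finitary : finitary_perm s.
Proof. exact: finitary_ext_perm. Qed.

Lemma sort_exponent x : (smact s (sp_monom L)).2 x = (sp_row L x).1.
Proof.
have sK : cancel (ext_perm w) s by exact: ext_permK.
have sI : injective s by case: sort_finitary => /bij_inj.
rewrite -{1}[x]sK act_mset // sp_monom_exponent -nth_decr_sp_comp.
have [xN|Nx] := ltnP x (m + n).
  rewrite -[x]/(val (Ordinal xN)) ext_permE -sp_compE min_permE.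
  by rewrite (tnth_nth 0).
by rewrite ext_perm_out // !nth_default // ?size_tuple // (leq_trans (size_sp_comp L)).
Qed.

Lemma sort_theta : perm_eq (smact s (sp_monom L)).1 [seq s i | i <- iota 0 m].
Proof.
have sI : injective s by case: sort_finitary => /bij_inj.
have /permPl -> := perm_imfset (sp_monom L).1 sI.
by apply: perm_map; exact: perm_fset_seq (iota_uniq _ _).
Qed.

Lemma sort_increasing i j : i < j -> j < m -> s i < s j.
Proof.
move=> ij jm; have jN : j < m + n by apply: leq_trans jm (leq_addr _ _).
rewrite /s -[i]/(val (Ordinal (ltn_trans ij jN))) -[j]/(val (Ordinal jN)) !ext_permE.
by apply: min_perm_inv_grassmannian; rewrite //= jm.
Qed.

Lemma inversions_sort : inversions s (sp_monom L).1 = 0.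
Proof.
rewrite /inversions big1_seq // => i _; rewrite big_seq_cond big1 // => j /andP[].
rewrite sp_monom_theta => jm ij.
by rewrite ltnNge ltnW // sort_increasing.
Qed.

Lemma sort_circled p : p < m -> s p = count (ltn (nth 0 L.1 p)) (sp_entries L).
Proof.
move=> pm; have pN : p < m + n by apply: leq_trans pm (leq_addr _ _).
by rewrite /s -[p]/(val (Ordinal pN)) ext_permE min_perm_inv_circled.
Qed.

End SortingPermutation.

Definition sp_sort n m (L : superpart n m) := ext_perm (min_perm (sp_comp L))^-1.

Lemma sp_monom_inj n m : injective (@sp_monom n m).
Proof.
move=> K L E; have := moves_id (sp_monom L); rewrite -{1}E => mv.
by have [] := orbit_unique finitary_id finitary_id mv (moves_id (sp_monom L)).
Qed.

Lemma sp_comp_inj n m : injective (@sp_comp n m).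
Proof.
move=> K L E; apply: sp_monom_inj; rewrite [LHS]surjective_pairing.
rewrite [RHS]surjective_pairing; congr (_, _); apply/msetP => x.
rewrite !sp_monom_exponent; have [xN|Nx] := ltnP x (m + n).
  by have := congr1 (fun t => tnth t (Ordinal xN)) E; rewrite !sp_compE.
by rewrite !nth_default // (leq_trans (size_sp_comp _)).
Qed.

(** * Conjugation *)

Lemma sp_row_conj n m (L : superpart n m) i :
  sp_row (sp_conj L) i = (count (ltn i) (sp_entries L), i \in L.1).
Proof.
have E1 : (sp_row (sp_conj L) i).1 = count (ltn i) (sp_entries L).
  apply: eq_from_ltn => j; have [h _] := sp_conjP L i j; move: h; rewrite /has_box => ->.
  rewrite /sp_row nth_fst nth_sorted_count ?sp_rows_geq //.
  by rewrite (seq.permP (perm_sp_rows L)).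
rewrite [LHS]surjective_pairing E1; congr (_, _).
set c := count _ _ in E1 *; have [_] := sp_conjP L i c.
rewrite /has_circle E1 eqxx andbT => ->.
transitivity (sp_row L c == (i, true)).
  by case: (sp_row L c) => x [] /=; rewrite xpair_eqE ?andbT ?andbF // eq_sym.
rewrite nth_sorted_row ?sp_rows_sorted //; last first.
  rewrite (seq.permP (perm_sp_rows' L)) count_cat !count_map.
  rewrite (@eq_count _ _ (pred1 i)) => [|k]; last by rewrite /= xpair_eqE andbT.
  rewrite (@eq_count _ (preim (fun k => (k, false)) _) pred0) => [|k]; last first.
    by rewrite /= xpair_eqE andbF.
  by rewrite count_pred0 addn0 count_uniq_mem ?leq_b1 // sp_uniq1.
rewrite mem_sp_rows /c -(seq.permP (perm_sp_rows L) (ltn i)) count_map.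
by rewrite eqxx andbT.
Qed.

Lemma sp_conj1 n m (L : superpart n m) :
  (sp_conj L).1 = rev [seq count (ltn j) (sp_entries L) | j <- L.1].
Proof.
suff -> : sp_conj L = Superpart (conj_valP L (erefl _)) by [].
by apply: sp_diagram_inj => i j; rewrite /has_box /has_circle sp_row_conj conj_row.
Qed.

Lemma sp_conjK n m : involutive (@sp_conj n m).
Proof.
move=> L; apply/esym/sp_conj_unique => i j.
by have [-> ->] := sp_conjP L j i.
Qed.

(** For a part [a] of [L.1], row [a] of the conjugate is strictly shorter than every row above it,
    so the number of strictly longer rows is [a] itself. *)
Lemma sp_sort_conj n m (L : superpart n m) p : p < m ->
  sp_sort (sp_conj L) p = nth 0 (rev L.1) p.
Proof.
move=> pm; rewrite /sp_sort sort_circled // sp_conj1 -map_rev.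
have pr : p < size (rev L.1) by rewrite size_rev sp_size1.
rewrite (nth_map 0) //; set a := nth 0 _ p.
have aE : a \in sp_entries L by rewrite mem_cat -mem_rev mem_nth.
apply: eq_from_ltn => j; rewrite -(seq.permP (perm_sp_rows (sp_conj L))).
rewrite -nth_sorted_count ?sp_rows_geq // -nth_fst -/(sp_row _ _) sp_row_conj /=.
have [ja|aj] := ltnP j a; first exact: count_ltn_homo.
by apply/negbTE; rewrite -leqNgt; exact: count_leq_homo.
Qed.

Lemma sp_sort_conj_seq n m (L : superpart n m) :
  [seq sp_sort (sp_conj L) i | i <- iota 0 m] = rev L.1.
Proof.
apply: (@eq_from_nth _ 0); first by rewrite size_map size_iota size_rev sp_size1.
move=> i; rewrite size_map size_iota => im.
by rewrite (nth_map 0) ?size_iota // nth_iota // sp_sort_conj.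
Qed.

Lemma sorted_rev_sp1 n m (L : superpart n m) : sorted ltn (rev L.1).
Proof. by rewrite rev_sorted; exact: sp_sorted1. Qed.

Lemma sorted_exponent_conj n m (L O : superpart n m) r :
  perm_eq r (sp_entries L) ->
  (forall x, (sp_row O x).1 = (sp_row (sp_conj L) x).1) ->
  (smact (sp_sort O) (sp_monom O)).2 = conj_mset r.
Proof.
move=> pr E; apply/msetP => x.
by rewrite sort_exponent E sp_row_conj conj_msetE (seq.permP pr).
Qed.

(** In an increasing list the entries at least [t] form a suffix. This converts counts of circles
    back into positions. *)
Lemma circ_ge_sorted (s : seq nat) t p : sorted ltn s -> p < size s ->
  (t <= nth 0 s p) = (size s - p <= circ_ge s t).
Proof.
rewrite /circ_ge; elim: s p => // x s IH p /=; rewrite (path_sortedE ltn_trans).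
move=> /andP[/allP xs ss].
have full : t <= x -> count (leq t) s = size s.
  move=> tx; apply/eqP; rewrite -all_count; apply/allP => y /xs xy.
  exact: leq_trans tx (ltnW xy).
have cs := count_size (leq t) s.
case: p => [|p] /= ps; rewrite ?IH // ?subSS ?subn0; case: (leqP t x) full => h full.
- by rewrite full // add1n leqnn.
- by rewrite add0n ltnNge cs.
- by rewrite full // add1n leqW leq_subr.
- by rewrite add0n.
Qed.

Lemma count_mem_sumn (A : {mset nat}%mset) t : uniq t ->
  count (mem t) A = sumn [seq A x | x <- t].
Proof.
elim: t => [|x t IH] /=; first by rewrite count_pred0.
move=> /andP[xt ut]; rewrite -IH // -count_mem_mset -count_predUI.
rewrite [X in _ = _ + X](@eq_count _ _ pred0) ?count_pred0 ?addn0.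
  by apply: eq_count => y; rewrite /= in_cons.
by move=> y /=; case: eqP => // ->; rewrite (negbTE xt).
Qed.

(** * Triangularity *)

Section Coefficients.
Variables (n m : nat) (L : superpart n m) (a : seq nat).
Hypothesis pa : perm_eq a L.1.
Let f := eprod a L.2.
Let K := sp_conj L.

Lemma perm_rows : perm_eq (a ++ L.2) (sp_entries L).
Proof. by rewrite perm_cat2r. Qed.

Lemma eprod_symsuper : symsuper n m f.
Proof.
split; last exact: perm_invariant_eprod.
have := @homogeneous_eprod a L.2.
by rewrite (perm_size pa) (perm_sumn pa) sp_sumn sp_size1.
Qed.

(** Sorting keeps the theta variables in order, so no sign appears. *)
Lemma eprod_sort (O : superpart n m) :
  f (smact (sp_sort O) (sp_monom O)) = f (sp_monom O).
Proof.
have /perm_invariantP h := perm_invariant_eprod a L.2.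
by rewrite /f h ?(inversions_sort O) ?mul1r //; exact: sort_finitary.
Qed.

(** The sorted representative of the orbit of the conjugate is the left-justified filling with a
    circle at the end of each circled row. *)
Lemma eprod_conj : f (sp_monom K) = ((-1) ^+ seq_inv a)%R.
Proof.
have ua : uniq a by rewrite (perm_uniq pa) sp_uniq1.
rewrite -eprod_sort -(lmon_eprod L.2 ua) /f; congr (eprod _ _ _).
set M := smact _ _; rewrite [M]surjective_pairing /lmon; congr (_, _).
  apply/fsetP => x; rewrite inE (perm_mem (sort_theta K)) (perm_mem pa) -[RHS]mem_rev.
  by rewrite -(sp_sort_conj_seq L).
exact: sorted_exponent_conj perm_rows _.
Qed.

(** Rewrites a partial sum of the rearrangement as a count over the [k] variables with the largest
    exponents, to which [bounded] applies. *)
Lemma sumn_take_decr (O : superpart n m) (k : nat) : k <= m + n ->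
  sumn (take k (decr (sp_comp O))) =
  count (mem (map (ext_perm (min_perm (sp_comp O))) (iota 0 k))) (sp_monom O).2.
Proof.
move=> kN; set w := min_perm _; have wI : injective (ext_perm w) := can_inj (ext_permK w).
transitivity (sumn [seq (sp_monom O).2 (ext_perm w i) | i <- iota 0 k]).
  congr sumn; apply: (@eq_from_nth _ 0).
    by rewrite size_map size_iota size_take size_tuple; case: ltngtP kN.
  rewrite size_take size_tuple => i ik; have {}ik : i < k by move: ik; case: ifP; lia.
  have iN : i < m + n by apply: leq_trans ik kN.
  rewrite nth_take // (nth_map 0) ?size_iota // nth_iota // add0n sp_monom_exponent.
  by rewrite -[i]/(val (Ordinal iN)) ext_permE -sp_compE min_permE (tnth_nth 0).
rewrite map_comp count_mem_sumn // map_inj_uniq ?iota_uniq //.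
Qed.

Lemma eprod_neq0_dominated O : f (sp_monom O) != 0%R ->
  dominated (decr (sp_comp O)) (decr (sp_comp K)).
Proof.
move=> nz; rewrite /dominated !sumn_decr_sp_comp eqxx /=; apply/forallP => -[k /= kN].
have -> : sumn (take k (decr (sp_comp K))) = row_sum (a ++ L.2) k.
  rewrite /row_sum (perm_big _ perm_rows) -/(row_sum _ _) -conj_mset_row_sum.
  rewrite count_mem_sumn ?iota_uniq //; congr sumn; apply: (@eq_from_nth _ 0).
    by rewrite size_map size_iota size_takel ?size_tuple.
  rewrite size_take size_tuple => i ik; have {}ik : i < k by move: ik; case: ifP; lia.
  rewrite nth_take // (nth_map 0) ?size_iota // nth_iota // add0n conj_msetE.
  by rewrite nth_decr_sp_comp sp_row_conj.
rewrite sumn_take_decr //; set t := map _ _.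
have st : size t = k by rewrite size_map size_iota.
rewrite -[X in row_sum _ X]st; apply: bounded_eprod nz _.
by rewrite map_inj_uniq ?iota_uniq //; exact: can_inj (ext_permK _).
Qed.

(** Equal rearrangements make the sorted monomial left-justified, so [circled] compares the circles
    with the parts of [L.1]. *)
Lemma eprod_neq0_circled O p : f (sp_monom O) != 0%R ->
  decr (sp_comp O) = decr (sp_comp K) -> p < m -> sp_sort K p <= sp_sort O p.
Proof.
rewrite -eprod_sort => nz E pm; set u := [seq sp_sort O i | i <- iota 0 m].
have rowE x : (sp_row O x).1 = (sp_row K x).1 by rewrite -!nth_decr_sp_comp E.
have su : size u = m by rewrite size_map size_iota.
have srt : sorted ltn u.
  rewrite sorted_map; apply: (@sub_in_sorted _ [in iota 0 m] ltn); last exact: iota_ltn_sorted.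
    move=> i j _ jm ij; apply: sort_increasing => //.
    by have : j \in iota 0 m := jm; rewrite mem_iota.
  by apply/allP.
have -> : sp_sort O p = nth 0 u p by rewrite (nth_map 0) ?size_iota // nth_iota.
rewrite sp_sort_conj // circ_ge_sorted ?su //.
(* The entry at position [p] is at least itself, so at least [m - p] parts of [L.1] are no smaller
   than it. *)
have /esym := leqnn (nth 0 (rev L.1) p).
rewrite circ_ge_sorted ?sorted_rev_sp1 ?size_rev ?sp_size1 // => /esym le.
apply: leq_trans le _; have := circled_eprod (nth 0 (rev L.1) p) nz.
rewrite /circ_ge (seq.permP (sort_theta O)) (seq.permP pa) count_rev; apply.
exact: sorted_exponent_conj perm_rows rowE.
Qed.

Lemma eprod_neq0_sp_le O : f (sp_monom O) != 0%R -> sp_le O K.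
Proof.
move=> nz; rewrite /sp_le /comp_le; have [E|_] := eqVneq; last first.
  by rewrite eprod_neq0_dominated.
apply: bruhat_inv_grassmannian (min_perm_inv_grassmannian K) (min_perm_inv_grassmannian O) _.
move=> p pm; have := eprod_neq0_circled nz E pm.
by rewrite /sp_sort !ext_permE.
Qed.

End Coefficients.

(** * Ranking superpartitions and inverting the triangular system *)

Lemma dominated_lt N (l k : N.-tuple nat) : dominated l k -> l != k ->
  \sum_(i < N.+1) sumn (take i l) < \sum_(i < N.+1) sumn (take i k).
Proof.
case/andP=> _ /forallP le ne.
rewrite ltn_neqAle leq_sum ?andbT => [|i _]; last exact: le.
(* Termwise inequalities with equal totals are equalities, and entries are differences of
   consecutive partial sums. *)
apply: contra ne => /eqP E; have {}E (i : 'I_N.+1) : sumn (take i l) = sumn (take i k).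
  apply/eqP; rewrite eqn_leq le leqNgt /=; apply/negP => lt; move: E; apply/eqP.
  rewrite ltn_eqF // (bigD1 i) //= [ltnRHS](bigD1 i) //= -addSn leq_add //.
  by apply: leq_sum => j _; exact: le.
apply/eqP/eq_from_tnth => i.
have iN : i < N.+1 by rewrite ltnS ltnW.
have := E (Ordinal (ltn_ord i : i.+1 < N.+1)); have := E (Ordinal iN) => /= E0.
rewrite !(take_nth 0) ?size_tuple // !sumn_rcons E0 => /addnI.
by rewrite -!tnth_nth.
Qed.

(* The sum of all partial sums is strictly monotone for dominance; the second
   term is at most (m + n)^2 and breaks ties by the length of the sorting
   permutation. *)
Definition sp_rank n m (L : superpart n m) : nat :=
  (\sum_(i < (m + n).+1) sumn (take i (decr (sp_comp L)))) * ((m + n) * (m + n)).+1 +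
  ((m + n) * (m + n) - perm_length (min_perm (sp_comp L))).

Lemma sp_rank_lt n m (O K : superpart n m) : sp_lt O K -> sp_rank O < sp_rank K.
Proof.
case/andP=> ne /orP[/andP[nd dom]|/andP[/eqP ed br]]; rewrite /sp_rank.
  have := dominated_lt dom nd; set x := \sum_(i < _) _; set y := \sum_(i < _) _.
  set N := (m + n) * (m + n); set u := perm_length _; set v := perm_length _.
  nia.
have lt : perm_length (min_perm (sp_comp K)) < perm_length (min_perm (sp_comp O)).
  have [e|//] := bruhat_le_length br; case/eqP: ne; apply: sp_comp_inj.
  apply: eq_from_tnth => p; rewrite -[p](permKV (min_perm (sp_comp O))) min_permE.
  by rewrite -e min_permE ed.
by rewrite ed ltn_add2l ltn_sub2l // (leq_trans lt (perm_length_bound _)).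
Qed.

(** After matching rows with columns by [g], the matrix [A] is triangular for [rank], and each
    diagonal entry is its own inverse, hence a unit over the integers. *)
Lemma Zbasis_triangular (V : zmodType) (P : set V) (I : finType) (b e : I -> V)
    (A : I -> I -> int) (g : I -> I) (rank : I -> nat) :
  (forall i, P (e i)) ->
  (forall c : I -> int, (\sum_i b i *~ c i = 0)%R -> forall i, c i = 0%R) ->
  (forall v, P v -> exists c : I -> int, (v = \sum_i b i *~ c i)%R) ->
  bijective g -> (forall i, e i = \sum_j b j *~ A i j)%R ->
  (forall i, A i (g i) * A i (g i) = 1)%R ->
  (forall i j, A i j != 0%R -> j != g i -> rank j < rank (g i)) ->
  Zbasis P e.
Proof.
move=> Pe indep span [g' gK g'K] eE A1 tri; split=> // [c c0|v /span[c ->]].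
  have {}c0 j : (\sum_i A i j * c i = 0)%R.
    apply: (indep (fun j => \sum_i A i j * c i)%R); rewrite -[RHS]c0.
    under [RHS]eq_bigr do rewrite eE mulrz_suml.
    rewrite exchange_big /=; apply: eq_bigr => k _; rewrite mulrz_sumr.
    by apply: eq_bigr => i _; rewrite mulrzA.
  move=> i; apply/eqP; apply: contraT => ci.
  (* Among the nonzero coefficients choose one of maximal rank: in column [g k] only its diagonal
     term can survive. *)
  case: (@arg_maxnP _ i (fun i => c i != 0%R) (fun i => rank (g i)) ci) => k ck kmax.
  have := c0 (g k); rewrite (bigD1 k) //= big1 ?addr0 => [/eqP|j jk].
    rewrite mulf_eq0 (negbTE ck) orbF => /eqP h; have := A1 k.
    by rewrite h mul0r.
  have [->|cj] := eqVneq (c j) 0%R; first by rewrite mulr0.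
  have [->|Aj] := eqVneq (A j (g k)) 0%R; first by rewrite mul0r.
  have lt : rank (g k) < rank (g j).
    by apply: tri Aj _; rewrite (inj_eq (can_inj gK)) eq_sym.
  by have := kmax _ cj; rewrite /= leqNgt lt.
pose S (v : V) := exists c : I -> int, (v = \sum_i e i *~ c i)%R.
have SD u v' : S u -> S v' -> S (u + v')%R.
  move=> [c1 ->] [c2 ->]; exists (fun i => c1 i + c2 i)%R; rewrite -big_split /=.
  by apply: eq_bigr => i _; rewrite mulrzDr.
have SZ u (z : int) : S u -> S (u *~ z)%R.
  move=> [c1 ->]; exists (fun i => c1 i * z)%R; rewrite mulrz_suml.
  by apply: eq_bigr => i _; rewrite mulrzA.
have S0 : S 0%R by exists (fun=> 0%R); rewrite big1 // => i _; rewrite mulr0z.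
have Se i : S (e i).
  exists (fun j => ((j == i : nat)%:Z)%R); rewrite (bigD1 i) //= eqxx big1 ?addr0 //.
  by move=> j /negbTE ->; rewrite mulr0z.
have Sb j : S (b j).
  have [d] := ubnP (rank j); elim: d j => // d IH j jd.
  (* Solve the expansion of [e (g' j)] for [b j]; the other vectors that occur have smaller rank. *)
  have -> : b j = ((e (g' j) - \sum_(k | k != j) b k *~ A (g' j) k) *~ A (g' j) j)%R.
    rewrite eE (bigD1 j) //= addrK -mulrzA.
    by have := A1 (g' j); rewrite g'K => ->.
  apply: (SZ); apply: (SD) => //; rewrite -mulrN1z; apply: (SZ).
  apply: (big_ind S) => // k kj; have [->|Ak] := eqVneq (A (g' j) k) 0%R.
    by rewrite mulr0z.
  apply: (SZ); apply: IH; have := tri _ _ Ak; rewrite g'K => /(_ kj) lt.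
  exact: leq_trans lt _.
by apply: (big_ind S) => // i _; exact: SZ.
Qed.

Theorem theorem18 (n m : nat) :
  (forall L : superpart n m, exists N : superpart n m -> int,
     e_sp_rev L = msuper (sp_conj L) +
                  \sum_(O : superpart n m | sp_lt O (sp_conj L)) msuper O *~ N O)%R /\
  Zbasis (symsuper n m) (@e_sp n m).
Proof.
split=> [L|].
  have pL : perm_eq (rev L.1) L.1 by rewrite perm_rev.
  exists (fun O => e_sp_rev L (sp_monom O)).
  rewrite /e_sp_rev [LHS](symsuper_msuper (eprod_symsuper pL)) (bigD1 (sp_conj L)) //=.
  (* The reversed antisymmetric part is increasing, so the leading sign is 1. *)
  rewrite (eprod_conj pL) (seq_inv_sorted (sorted_rev_sp1 L)) expr0; congr (_ + _)%R.
  rewrite [LHS]big_mkcond [RHS]big_mkcond; apply: eq_bigr => O _; rewrite /sp_lt.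
  case: eqP => //= _; case: ifPn => // nle.
  have [->|/(eprod_neq0_sp_le pL)] := eqVneq (eprod (rev L.1) L.2 (sp_monom O)) 0%R.
    by rewrite mulr0z.
  by rewrite (negbTE nle).
apply: (@Zbasis_triangular _ _ _ (@msuper n m) _ (fun L O => e_sp L (sp_monom O))
  (@sp_conj n m) (@sp_rank n m)).
- by move=> L; exact: eprod_symsuper (perm_refl _).
- move=> c c0 L; have := congr1 (fun f => f (sp_monom L)) c0.
  rewrite fct_sumE (bigD1 L) //= mulrz_fctE msuper_sp_monom eqxx mul1r big1 ?addr0 //.
  by move=> K /negbTE KL; rewrite mulrz_fctE msuper_sp_monom KL mul0r.
- by move=> f /symsuper_msuper h; exists (fun K => f (sp_monom K)).
- by exists (@sp_conj n m); exact: sp_conjK.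
- by move=> L; exact: symsuper_msuper (eprod_symsuper (perm_refl _)).
(* In the original order the leading coefficient is a sign, whose square is 1. *)
- by move=> L; rewrite /e_sp (eprod_conj (perm_refl _)) -expr2 sqrr_sign.
- move=> L O nz OL; apply: sp_rank_lt; rewrite /sp_lt OL /=.
  exact: eprod_neq0_sp_le (perm_refl _) _ nz.
Qed.
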